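(* Let $(\omega,c)\in\mathbb{R}^2$ satisfy: $\omega>c^2/4$, or $\omega=c^2/4$ and $c>0$. Then $$\lim_{L\to\infty}\bigl\|\Phi^L_{\omega,c}-\Phi_{\omega,c}\bigr\|_{H^m([-L,L])}=0\qquad\text{for } m=0,1,2.$$
   Context: Set $\alpha_0=\tfrac13(4c+\sqrt{48\omega+4c^2})$, $\alpha_1=4\sqrt\omega+2c$, $A(x)=-3x^2+8cx+64\omega$, $L_0(\omega,c)=2\pi/\sqrt{\alpha_0\sqrt{A(\alpha_0)}}$. For $\eta_3\in(\alpha_0,\alpha_1)$ put $\eta_1=\frac{-\eta_3+4c-\sqrt{A(\eta_3)}}{2}$, $\eta_2=\frac{-\eta_3+4c+\sqrt{A(\eta_3)}}{2}$, $k^2=\frac{-\eta_1(\eta_3-\eta_2)}{\eta_3(\eta_2-\eta_1)}\in(0,1)$, $g=\frac{2}{\sqrt{\eta_3(\eta_2-\eta_1)}}$, $\beta^2=-\eta_3k^2/\eta_1$, $T(\eta_3)=4gK(k)$ with $K(k)=\int_0^{\pi/2}(1-k^2\sin^2\theta)^{-1/2}d\theta$. The map $T$ is a strictly increasing bijection of $(\alpha_0,\alpha_1)$ onto $(2L_0,\infty)$; for $L>L_0$ let $\eta_3$ satisfy $T(\eta_3)=2L$, and let $\Phi^L_{\omega,c}>0$ on $[-L,L]$ be given by $(\Phi^L_{\omega,c}(x))^2=\eta_3\,\mathrm{dn}^2(\frac{x}{2g};k)/(1+\beta^2\mathrm{sn}^2(\frac{x}{2g};k))$ ($\mathrm{sn},\mathrm{dn}$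 Jacobi elliptic functions of modulus $k$). $\Phi_{\omega,c}>0$ on $\mathbb{R}$ is given by $\Phi_{\omega,c}^2(x)=\frac{4\omega-c^2}{\sqrt\omega(\cosh(\sqrt{4\omega-c^2}x)-\frac{c}{2\sqrt\omega})}$ if $\omega>c^2/4$, and $\Phi_{\omega,c}^2(x)=\frac{4c}{(cx)^2+1}$ if $\omega=c^2/4,\ c>0$. $H^m([-L,L])$ is the standard Sobolev space on the interval ($H^0=L^2$). *)

(* Defs.v *)
From Stdlib Require Import Reals Lra ClassicalEpsilon.
From Coquelicot Require Import Coquelicot.
Open Scope R_scope.

Section Defs.
Variables (w c : R).

Definition alpha0 : R := (4 * c + sqrt (48 * w + 4 * c ^ 2)) / 3.
Definition alpha1 : R := 4 * sqrt w + 2 * c.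
Definition Apol (x : R) : R := - 3 * x ^ 2 + 8 * c * x + 64 * w.
Definition L0 : R := 2 * PI / sqrt (alpha0 * sqrt (Apol alpha0)).

Definition eta1 (e3 : R) : R := (- e3 + 4 * c - sqrt (Apol e3)) / 2.
Definition eta2 (e3 : R) : R := (- e3 + 4 * c + sqrt (Apol e3)) / 2.
Definition ksq (e3 : R) : R :=
  - eta1 e3 * (e3 - eta2 e3) / (e3 * (eta2 e3 - eta1 e3)).
Definition kmod (e3 : R) : R := sqrt (ksq e3).
Definition gpar (e3 : R) : R := 2 / sqrt (e3 * (eta2 e3 - eta1 e3)).
Definition betasq (e3 : R) : R := - e3 * ksq e3 / eta1 e3.
End Defs.

Definition EllF (k phi : R) : R :=
  RInt (fun th => / sqrt (1 - k ^ 2 * (sin th) ^ 2)) 0 phi.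
Definition EllK (k : R) : R := EllF k (PI / 2).

Definition am (k u : R) : R :=
  epsilon (inhabits 0) (fun phi => EllF k phi = u).
Definition sn (k u : R) : R := sin (am k u).
Definition dn (k u : R) : R := sqrt (1 - k ^ 2 * (sn k u) ^ 2).

Definition Tper (w c e3 : R) : R := 4 * gpar w c e3 * EllK (kmod w c e3).

(* eta_3 in (alpha0, alpha1) with T(eta_3) = 2L (unique since T is a bijection). *)
Definition eta3L (w c L : R) : R :=
  epsilon (inhabits 0)
    (fun e => alpha0 w c < e < alpha1 w c /\ Tper w c e = 2 * L).

(* Periodic wave Phi^L_{omega,c} (formula on R; only [-L,L] is used). *)
Definition PhiL (w c L x : R) : R :=
  let e3 := eta3L w c L in
  let k := kmod w c e3 in
  let u := x / (2 * gpar w c e3) in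
  sqrt (e3 * (dn k u) ^ 2 / (1 + betasq w c e3 * (sn k u) ^ 2)).

Definition Phi (w c x : R) : R :=
  if Rlt_dec (c ^ 2 / 4) w then
    sqrt ((4 * w - c ^ 2) /
          (sqrt w * (cosh (sqrt (4 * w - c ^ 2) * x) - c / (2 * sqrt w))))
  else sqrt (4 * c / ((c * x) ^ 2 + 1)).

Definition Hnorm (m : nat) (L : R) (f : R -> R) : R :=
  sqrt (sum_f_R0 (fun j => RInt (fun x => (Derive_n f j x) ^ 2) (- L) L) m).

(* Main.v *)
Require Import Defs.
From Stdlib Require Import Reals.
From Coquelicot Require Import Coquelicot.
From Stdlib Require Import Lra Lia Psatz ClassicalEpsilon Ranalysis5.
Open Scope R_scope.

(* Both profiles solve the same equation [u'' = a u + (c/2) u^3 - (3/16) u^5], [a = w - c^2/4].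
   Since [K(k) <= PI / (2 sqrt (1 - k^2))], the condition [T(eta3) = 2 L] forces
   [eta2 (eta3 - eta1) <= (2 PI / L)^2], hence [eta3 -> alpha1]: the initial data at [x = 0] converge,
   and Gronwall gives uniform convergence of the profiles on compact sets. For the tails, put
   [phi = (Phi^L)^2] and [s = sqrt (phi - eta2)]; then [16 s'^2 = phi (phi - eta1) (eta3 - phi)],
   so [phi <= - C s'] away from the crest and the integral of [phi] over [[R, L]] is at most [C s(R)],
   uniformly in [L]. This is the [L^2] convergence; the first derivative follows by integrating
   [D'^2] by parts, the second from the equation. *)

(** The solitary wave decays exponentially for [w > c^2/4] but only like [1/x] when [w = c^2/4], so
    an argument that covers both cases cannot rest on a rate of decay; the inequality for [s] needs
    none. It could not be written for [phi] itself: [phi'^2 = phi (phi - eta1) (phi - eta2) (eta3 -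
    phi) / 4] vanishes at the trough, where [phi = eta2 > 0]. Passing to [s] divides out the
    degenerate factor [phi - eta2], which has a double zero there, and [eta1 < 0] gives
    [phi - eta1 >= phi]. The solitary wave satisfies the same inequality with 0 in place of [eta2];
    the record [wave] therefore treats both profiles at once. Since [am] and [eta3L] are chosen by
    [epsilon], their defining equations must first be shown solvable. For [eta3L] this takes
    continuity of the period and its divergence at [alpha1], where [eta2] vanishes. *)

(** * Calculus: comparison of integrals, parity, inverse functions *)

Lemma is_derive_continuous (f : R -> R) (x l : R) : is_derive f x l -> continuous f x.
Proof. intros H. apply (ex_derive_continuous f). now exists l. Qed.

Lemma ex_RInt_everywhere_continuous (f : R -> R) (a b : R) :
  (forall x, continuous f x) -> ex_RInt f a b.
Proof. intros H. apply (ex_RInt_continuous f). intros; apply H. Qed.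

Lemma derive_nonneg_incr (f df : R -> R) (a b : R) :
  a <= b -> (forall x, a <= x <= b -> is_derive f x (df x)) ->
  (forall x, a <= x <= b -> 0 <= df x) -> f a <= f b.
Proof.
intros Hab Hd Hp.
destruct (MVT_gen f a b df) as [z [Hz E]].
- intros x Hx. rewrite Rmin_left, Rmax_right in Hx by lra. apply Hd; lra.
- intros x Hx. rewrite Rmin_left, Rmax_right in Hx by lra.
  apply continuity_pt_filterlim. apply (is_derive_continuous f x (df x)). apply Hd; lra.
- rewrite Rmin_left, Rmax_right in Hz by lra. specialize (Hp z Hz). nra.
Qed.

Lemma is_derive_primitive (f : R -> R) (a x : R) :
  (forall y, continuous f y) -> is_derive (fun y => RInt f a y) x (f x).
Proof.
intros Hf. apply (is_derive_RInt f (fun y => RInt f a y) a); [|apply Hf].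
apply filter_forall. intros y. apply (RInt_correct f).
now apply ex_RInt_everywhere_continuous.
Qed.

Lemma RInt_ge_increment (f g dg : R -> R) (a b : R) :
  a <= b -> (forall x, continuous f x) ->
  (forall x, a <= x <= b -> is_derive g x (dg x)) ->
  (forall x, a <= x <= b -> dg x <= f x) -> g b - g a <= RInt f a b.
Proof.
intros Hab Hf Hg Hle.
assert (H : RInt f a a - g a <= RInt f a b - g b).
{ apply (derive_nonneg_incr (fun x => RInt f a x - g x) (fun x => f x - dg x)); try easy.
  - intros x Hx. apply (is_derive_minus (fun x => RInt f a x) g).
    + now apply is_derive_primitive.
    + now apply Hg.
  - intros x Hx. specialize (Hle x Hx). lra. }
rewrite RInt_point in H. change (@zero R_CompleteNormedModule) with 0 in H. lra.
Qed.

Lemma RInt_le_increment (f g dg : R -> R) (a b : R) :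
  a <= b -> (forall x, continuous f x) ->
  (forall x, a <= x <= b -> is_derive g x (dg x)) ->
  (forall x, a <= x <= b -> f x <= dg x) -> RInt f a b <= g b - g a.
Proof.
intros Hab Hf Hg Hle.
assert (H : g a - RInt f a a <= g b - RInt f a b).
{ apply (derive_nonneg_incr (fun x => g x - RInt f a x) (fun x => dg x - f x)); try easy.
  - intros x Hx. apply (is_derive_minus g (fun x => RInt f a x)).
    + now apply Hg.
    + now apply is_derive_primitive.
  - intros x Hx. specialize (Hle x Hx). lra. }
rewrite RInt_point in H. change (@zero R_CompleteNormedModule) with 0 in H. lra.
Qed.

Lemma RInt_primitive_odd (f : R -> R) (x : R) :
  (forall x, continuous f x) -> (forall x, f (- x) = f x) ->
  RInt f 0 (- x) = - RInt f 0 x.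
Proof.
intros Hf He.
assert (H := RInt_comp_lin f (-1) 0 0 x).
replace (-1 * 0 + 0) with 0 in H by ring.
replace (-1 * x + 0) with (- x) in H by ring.
rewrite <- H by now apply ex_RInt_everywhere_continuous.
rewrite <- (RInt_opp f) by now apply ex_RInt_everywhere_continuous.
apply RInt_ext. intros y _.
replace (-1 * y + 0) with (- y) by ring. rewrite He.
unfold scal, opp; simpl; unfold mult; simpl. ring.
Qed.

Lemma RInt_even (f : R -> R) (L : R) :
  (forall x, continuous f x) -> (forall x, f (- x) = f x) ->
  RInt f (- L) L = 2 * RInt f 0 L.
Proof.
intros Hf He.
rewrite <- (RInt_Chasles f (- L) 0 L) by now apply ex_RInt_everywhere_continuous.
rewrite <- (opp_RInt_swap f) by now apply ex_RInt_everywhere_continuous.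
rewrite RInt_primitive_odd by easy.
unfold plus, opp; simpl. ring.
Qed.

(** An increment [p] of [G] over a step [h] satisfies [|p| <= |h|], so the radius that works for [F]
    at [G u] also works for [G] at [u]. *)
Lemma is_derive_expanding_inverse (F G : R -> R) (u l : R) :
  (forall v, F (G v) = v) ->
  (forall v w, Rabs (G v - G w) <= Rabs (v - w)) ->
  1 <= l -> is_derive F (G u) l -> is_derive G u (/ l).
Proof.
intros HFG Hlip Hl HF. apply is_derive_Reals. apply is_derive_Reals in HF.
intros eps Heps. destruct (HF eps Heps) as [d Hd].
exists d. intros h Hh0 Hh.
destruct (Req_dec (G (u + h)) (G u)) as [E|E].
{ exfalso. apply Hh0. generalize (HFG (u + h)). rewrite E, HFG. lra. }
set (p := G (u + h) - G u).
assert (Hp : p <> 0) by (unfold p; lra).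
assert (Hph : Rabs p <= Rabs h).
{ unfold p. replace h with (u + h - u) at 2 by ring. apply Hlip. }
specialize (Hd p Hp (Rle_lt_trans _ _ _ Hph Hh)).
replace (G u + p) with (G (u + h)) in Hd by (unfold p; ring).
rewrite !HFG in Hd. replace (u + h - u) with h in Hd by ring.
(* The error of [p / h] is that of [h / p] multiplied by [p / h] and [/ l], both at most 1 in
   absolute value. *)
replace (p / h - / l) with (- ((h / p - l) * (p / h) * / l)) by (field; repeat split; lra).
rewrite Rabs_Ropp, !Rabs_mult.
assert (H1 : Rabs (p / h) <= 1).
{ unfold Rdiv. rewrite Rabs_mult, Rabs_inv.
  apply Rmult_le_reg_r with (Rabs h); [now apply Rabs_pos_lt|].
  rewrite Rmult_assoc, Rinv_l by (apply Rabs_no_R0; easy). lra. }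
assert (H2 : 0 <= Rabs (/ l) <= 1).
{ split; [apply Rabs_pos|]. rewrite Rabs_right.
  - rewrite <- Rinv_1. apply Rinv_le_contravar; lra.
  - apply Rle_ge. left. apply Rinv_0_lt_compat; lra. }
generalize (Rabs_pos (h / p - l)) (Rabs_pos (p / h)). intros.
assert (Rabs (h / p - l) * Rabs (p / h) <= Rabs (h / p - l) * 1) by (apply Rmult_le_compat_l; lra).
assert (Rabs (h / p - l) * Rabs (p / h) * Rabs (/ l) <= Rabs (h / p - l) * Rabs (p / h) * 1).
{ apply Rmult_le_compat_l; [|lra]. now apply Rmult_le_pos. }
lra.
Qed.

(** * The elliptic integral and the amplitude function *)

Lemma sin_sqr_bounds (th : R) : 0 <= sin th ^ 2 <= 1.
Proof. generalize (sin2_cos2 th). unfold Rsqr. nra. Qed.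

Lemma one_minus_ksin_pos (k th : R) : k ^ 2 < 1 -> 0 < 1 - k ^ 2 <= 1 - k ^ 2 * sin th ^ 2.
Proof. intros Hk. generalize (sin_sqr_bounds th) (pow2_ge_0 k). nra. Qed.

Lemma ellint_ge_1 (k th : R) : k ^ 2 < 1 -> 1 <= / sqrt (1 - k ^ 2 * sin th ^ 2).
Proof.
intros Hk. rewrite <- Rinv_1.
assert (H := one_minus_ksin_pos k th Hk).
apply Rinv_le_contravar; [apply sqrt_lt_R0; lra|].
rewrite <- sqrt_1 at 2. apply sqrt_le_1_alt.
generalize (sin_sqr_bounds th) (pow2_ge_0 k). nra.
Qed.

Lemma ellint_continuous (k th : R) :
  k ^ 2 < 1 -> continuous (fun t => / sqrt (1 - k ^ 2 * sin t ^ 2)) th.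
Proof.
intros Hk. apply (ex_derive_continuous (fun t => / sqrt (1 - k ^ 2 * sin t ^ 2))).
assert (H := one_minus_ksin_pos k th Hk). assert (Hs : sqrt (1 - k ^ 2 * sin th ^ 2) <> 0).
{ apply Rgt_not_eq, sqrt_lt_R0; lra. }
auto_derive. simpl in H, Hs. unfold Rminus in H, Hs. repeat split; [lra|apply Hs].
Qed.

Lemma is_derive_EllF (k phi : R) :
  k ^ 2 < 1 -> is_derive (EllF k) phi (/ sqrt (1 - k ^ 2 * sin phi ^ 2)).
Proof.
intros Hk. apply (is_derive_primitive (fun th => / sqrt (1 - k ^ 2 * sin th ^ 2)) 0).
intros; now apply ellint_continuous.
Qed.

(** The integrand is at least 1. Surjectivity and injectivity of [EllF k] and the Lipschitz bound
    for its inverse [am k] all rest on this inequality. *)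
Lemma EllF_expanding (k a b : R) : k ^ 2 < 1 -> a <= b -> b - a <= EllF k b - EllF k a.
Proof.
intros Hk Hab.
assert (EllF k a - a <= EllF k b - b); [|lra].
apply (derive_nonneg_incr (fun x => EllF k x - x) (fun x => / sqrt (1 - k ^ 2 * sin x ^ 2) - 1)); try easy.
- intros x _. apply (is_derive_minus (EllF k) (fun x => x)).
  + now apply is_derive_EllF.
  + apply (is_derive_id (K := R_AbsRing)).
- intros x _. generalize (ellint_ge_1 k x Hk). lra.
Qed.

Lemma EllF_0 (k : R) : EllF k 0 = 0.
Proof. unfold EllF. now rewrite RInt_point. Qed.

Lemma EllF_odd (k phi : R) : k ^ 2 < 1 -> EllF k (- phi) = - EllF k phi.
Proof.
intros Hk. apply (RInt_primitive_odd (fun th => / sqrt (1 - k ^ 2 * sin th ^ 2))).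
- intros; now apply ellint_continuous.
- intros x. rewrite sin_neg. now replace ((- sin x) ^ 2) with (sin x ^ 2) by ring.
Qed.

Lemma EllF_am (k u : R) : k ^ 2 < 1 -> EllF k (am k u) = u.
Proof.
intros Hk. unfold am. apply epsilon_spec.
(* Expansion gives [EllF k B >= B > |u|], and oddness handles the other end, so [[-B, B]] contains a
   preimage of [u]. *)
set (B := Rabs u + 1).
assert (HB : Rabs u < B) by (unfold B; lra).
assert (H0 : B <= EllF k B).
{ generalize (EllF_expanding k 0 B Hk), (Rabs_pos u). rewrite EllF_0. lra. }
destruct (IVT_interv (fun x => EllF k x - u) (- B) B) as [z [Hz E]].
- intros a _. apply continuity_pt_filterlim.
  apply (is_derive_continuous (fun x => EllF k x - u) a (/ sqrt (1 - k ^ 2 * sin a ^ 2) - 0)).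
  apply (is_derive_minus (EllF k) (fun _ => u)); [now apply is_derive_EllF|apply (is_derive_const u)].
- generalize (Rabs_pos u); lra.
- rewrite EllF_odd by easy. apply Rabs_def2 in HB. lra.
- apply Rabs_def2 in HB. lra.
- exists z. lra.
Qed.

Lemma EllF_inj (k a b : R) : k ^ 2 < 1 -> EllF k a = EllF k b -> a = b.
Proof.
intros Hk E. destruct (Rle_dec a b) as [H|H].
- generalize (EllF_expanding k a b Hk H). lra.
- generalize (EllF_expanding k b a Hk). lra.
Qed.

Lemma am_0 (k : R) : k ^ 2 < 1 -> am k 0 = 0.
Proof. intros Hk. apply (EllF_inj k); try easy. now rewrite EllF_am, EllF_0. Qed.

Lemma am_odd (k u : R) : k ^ 2 < 1 -> am k (- u) = - am k u.
Proof. intros Hk. apply (EllF_inj k); try easy. now rewrite EllF_odd, !EllF_am. Qed.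

Lemma am_EllK (k : R) : k ^ 2 < 1 -> am k (EllK k) = PI / 2.
Proof. intros Hk. apply (EllF_inj k); try easy. now rewrite EllF_am. Qed.

Lemma am_mono (k u v : R) : k ^ 2 < 1 -> u <= v -> am k u <= am k v.
Proof.
intros Hk Huv. destruct (Rle_dec (am k u) (am k v)) as [H|H]; [easy|].
generalize (EllF_expanding k (am k v) (am k u) Hk). rewrite !EllF_am by easy. lra.
Qed.

Lemma is_derive_am (k u : R) :
  k ^ 2 < 1 -> is_derive (am k) u (sqrt (1 - k ^ 2 * sin (am k u) ^ 2)).
Proof.
intros Hk. rewrite <- (Rinv_inv (sqrt _)).
apply (is_derive_expanding_inverse (EllF k)).
- intros v. now apply EllF_am.
- assert (H : forall v w, v <= w -> Rabs (am k v - am k w) <= Rabs (v - w)).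
  { intros v w Hvw. assert (Hm := am_mono k v w Hk Hvw).
    generalize (EllF_expanding k (am k v) (am k w) Hk Hm). rewrite !EllF_am by easy.
    intros. rewrite (Rabs_minus_sym (am k v)), (Rabs_minus_sym v), !Rabs_right; lra. }
  intros v w. destruct (Rle_dec v w); [now apply H|].
  rewrite (Rabs_minus_sym (am k v)), (Rabs_minus_sym v). apply H; lra.
- now apply ellint_ge_1.
- now apply is_derive_EllF.
Qed.

Lemma EllK_upper (k : R) : k ^ 2 < 1 -> EllK k <= PI / 2 / sqrt (1 - k ^ 2).
Proof.
intros Hk. unfold EllK, EllF.
evar_last.
- apply (RInt_le_increment _ (fun x => x / sqrt (1 - k ^ 2)) (fun _ => / sqrt (1 - k ^ 2))).
  + generalize PI_RGT_0; lra.
  + intros; now apply ellint_continuous.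
  + intros x _. unfold Rdiv. set (d := / sqrt (1 - k ^ 2)). auto_derive; [easy|ring].
  + intros x _. assert (H := one_minus_ksin_pos k x Hk).
    apply Rinv_le_contravar; [apply sqrt_lt_R0; lra|]. apply sqrt_le_1_alt; lra.
- unfold Rdiv; ring.
Qed.

(* [q^2 (1 - k^2 sin^2) = p^2 + q^2 k^2 cos^2 <= (p + Q (PI/2 - th))^2]. *)
Lemma EllK_lower (k p q Q : R) :
  0 < p -> 0 < q <= Q -> p ^ 2 = q ^ 2 * (1 - k ^ 2) ->
  q / Q * ln (1 + PI / 2 * Q / p) <= EllK k.
Proof.
intros Hp Hq Hk. assert (HP := PI_RGT_0). assert (Hk1 : k ^ 2 < 1) by nra.
replace (q / Q * ln (1 + PI / 2 * Q / p))
  with (- (q / Q) * ln (p + Q * (PI / 2 - PI / 2)) - - (q / Q) * ln (p + Q * (PI / 2 - 0))).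
2:{ replace (1 + PI / 2 * Q / p) with ((p + Q * (PI / 2)) / p) by (field; lra).
    replace (p + Q * (PI / 2 - PI / 2)) with p by ring. rewrite Rminus_0_r.
    assert (H : 0 < p + Q * (PI / 2)) by nra. set (z := p + Q * (PI / 2)) in *.
    rewrite ln_div by lra. ring. }
unfold EllK, EllF.
apply (RInt_ge_increment _ (fun x => - (q / Q) * ln (p + Q * (PI / 2 - x)))
         (fun x => q / (p + Q * (PI / 2 - x)))).
- lra.
- intros; now apply ellint_continuous.
- intros x Hx. assert (0 < p + Q * (PI / 2 - x)) by nra.
  auto_derive; [lra|]. field; lra.
- intros x Hx. assert (H := one_minus_ksin_pos k x Hk1).
  assert (0 < p + Q * (PI / 2 - x)) by nra.
  replace (q / (p + Q * (PI / 2 - x))) with (/ ((p + Q * (PI / 2 - x)) / q)) by (field; lra).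
  apply Rinv_le_contravar; [apply sqrt_lt_R0; lra|].
  assert (Hy : 0 <= (p + Q * (PI / 2 - x)) / q) by (apply Rdiv_le_0_compat; lra).
  rewrite <- (sqrt_pow2 ((p + Q * (PI / 2 - x)) / q)) by easy. apply sqrt_le_1_alt.
  assert (Hc : 0 <= cos x <= PI / 2 - x).
  { split; [apply cos_ge_0; lra|]. rewrite <- sin_shift.
    destruct (Req_dec x (PI / 2)) as [->|Hne].
    - replace (PI / 2 - PI / 2) with 0 by ring. rewrite sin_0. lra.
    - left. apply sin_lt_x. lra. }
  generalize (sin2_cos2 x). unfold Rsqr. intros E.
  apply Rmult_le_reg_l with (q ^ 2); [nra|].
  replace (q ^ 2 * ((p + Q * (PI / 2 - x)) / q) ^ 2) with ((p + Q * (PI / 2 - x)) ^ 2) by (field; lra).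
  replace (q ^ 2 * (1 - k ^ 2 * sin x ^ 2)) with (p ^ 2 + k ^ 2 * (q * cos x) ^ 2)
    by (rewrite Hk; replace (sin x ^ 2) with (1 - cos x ^ 2) by nra; ring).
  assert (0 <= q * cos x <= Q * (PI / 2 - x)) by (split; [nra|apply Rmult_le_compat; lra]).
  assert ((q * cos x) ^ 2 <= (Q * (PI / 2 - x)) ^ 2) by nra.
  generalize (pow2_ge_0 k) (pow2_ge_0 (q * cos x)). nra.
Qed.

(* [1/a - 1/b = (b^2 - a^2) / (a b (a + b))] with [a, b >= d]. *)
Lemma EllK_lipschitz (k l d : R) :
  0 < d -> d ^ 2 <= 1 - k ^ 2 -> d ^ 2 <= 1 - l ^ 2 ->
  Rabs (EllK k - EllK l) <= PI / 2 * (Rabs (k ^ 2 - l ^ 2) / (2 * d ^ 3)).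
Proof.
intros Hd Hk Hl. assert (HP := PI_RGT_0).
assert (Hk1 : k ^ 2 < 1) by nra. assert (Hl1 : l ^ 2 < 1) by nra.
unfold EllK, EllF.
assert (X : forall j, j ^ 2 < 1 -> ex_RInt (fun th => / sqrt (1 - j ^ 2 * sin th ^ 2)) 0 (PI / 2)).
{ intros j Hj. apply ex_RInt_everywhere_continuous. intros; now apply ellint_continuous. }
rewrite <- (RInt_minus (fun th => / sqrt (1 - k ^ 2 * sin th ^ 2))) by now apply X.
rewrite <- (Rminus_0_r (PI / 2)) at 2.
apply abs_RInt_le_const.
- lra.
- apply (ex_RInt_minus (fun th => / sqrt (1 - k ^ 2 * sin th ^ 2))); now apply X.
- intros t _. unfold minus, plus, opp; simpl.
  change (sin t * (sin t * 1)) with (sin t ^ 2).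
  change (k * (k * 1)) with (k ^ 2). change (l * (l * 1)) with (l ^ 2).
  assert (Hs := sin_sqr_bounds t).
  assert (B : forall j, d ^ 2 <= 1 - j ^ 2 -> d <= sqrt (1 - j ^ 2 * sin t ^ 2)).
  { intros j Hj. rewrite <- (sqrt_pow2 d) by lra. apply sqrt_le_1_alt.
    generalize (pow2_ge_0 j). nra. }
  assert (Ba := B k Hk). assert (Bb := B l Hl).
  assert (Ea : sqrt (1 - k ^ 2 * sin t ^ 2) ^ 2 = 1 - k ^ 2 * sin t ^ 2).
  { apply pow2_sqrt. generalize (one_minus_ksin_pos k t Hk1); lra. }
  assert (Eb : sqrt (1 - l ^ 2 * sin t ^ 2) ^ 2 = 1 - l ^ 2 * sin t ^ 2).
  { apply pow2_sqrt. generalize (one_minus_ksin_pos l t Hl1); lra. }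
  set (a := sqrt (1 - k ^ 2 * sin t ^ 2)) in *. set (b := sqrt (1 - l ^ 2 * sin t ^ 2)) in *.
  replace (/ a + - / b) with ((k ^ 2 - l ^ 2) * (sin t ^ 2 * / (a * b * (a + b)))).
  2:{ replace (/ a + - / b) with ((b ^ 2 - a ^ 2) * / (a * b * (a + b))) by (field; lra).
      rewrite Ea, Eb. ring. }
  rewrite Rabs_mult. apply Rmult_le_compat_l; [apply Rabs_pos|].
  assert (D : 2 * d ^ 3 <= a * b * (a + b)).
  { replace (2 * d ^ 3) with (d * d * (d + d)) by ring.
    apply Rmult_le_compat; [nra|lra| |lra]. apply Rmult_le_compat; lra. }
  assert (D0 : 0 < 2 * d ^ 3) by (generalize (pow_lt d 3 Hd); lra).
  assert (I : / (a * b * (a + b)) <= / (2 * d ^ 3)) by now apply Rinv_le_contravar.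
  assert (I0 : 0 < / (a * b * (a + b))) by (apply Rinv_0_lt_compat; lra).
  rewrite Rabs_right; [|apply Rle_ge, Rmult_le_pos; [apply Hs|apply Rlt_le, I0]].
  apply Rle_trans with (1 * / (a * b * (a + b))); [|rewrite Rmult_1_l; exact I].
  apply Rmult_le_compat_r; [apply Rlt_le, I0|apply Hs].
Qed.

(** * The roots and the period map *)

Definition admissible (w c : R) : Prop := c ^ 2 / 4 < w \/ (w = c ^ 2 / 4 /\ 0 < c).

(** The equality [c = 2 * sqrt w] is exactly the algebraically decaying case. *)
Lemma admissible_sqrt (w c : R) :
  admissible w c ->
  0 < w /\ 0 < sqrt w /\ sqrt w ^ 2 = w /\ - 2 * sqrt w < c <= 2 * sqrt w.
Proof.
intros H.
assert (Hw : 0 < w) by (destruct H as [H|[H Hc]]; nra).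
assert (Hs := sqrt_lt_R0 w Hw). assert (E := pow2_sqrt w (Rlt_le _ _ Hw)).
repeat split; try easy.
- destruct H as [H|[H Hc]]; nra.
- destruct H as [H|[H Hc]]; nra.
Qed.

(** [alpha0] is where [Apol x = (3 x - 4 c)^2], that is, where [eta2] and [eta3] merge. *)
Lemma alpha0_spec (w c : R) :
  admissible w c ->
  0 < 3 * alpha0 w c - 4 * c /\ (3 * alpha0 w c - 4 * c) ^ 2 = 48 * w + 4 * c ^ 2.
Proof.
intros H. destruct (admissible_sqrt w c H) as (Hw & HW & EW & Hc).
unfold alpha0. assert (P : 0 < 48 * w + 4 * c ^ 2) by nra.
replace (3 * ((4 * c + sqrt (48 * w + 4 * c ^ 2)) / 3) - 4 * c)
  with (sqrt (48 * w + 4 * c ^ 2)) by field.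
split; [now apply sqrt_lt_R0|apply pow2_sqrt; lra].
Qed.

Lemma alpha0_bounds (w c : R) :
  admissible w c -> 0 < alpha0 w c < alpha1 w c /\ 0 < alpha0 w c - 2 * c + 4 * sqrt w.
Proof.
intros H. destruct (admissible_sqrt w c H) as (Hw & HW & EW & Hc).
destruct (alpha0_spec w c H) as [P E]. unfold alpha1.
set (W := sqrt w) in *. set (a := alpha0 w c) in *. clearbody W a. subst w.
assert (0 < a) by nra.
repeat split; [easy| |nra].
assert (3 * a - 4 * c < 12 * W + 2 * c); [|lra]. nra.
Qed.

Section Roots.
Variables (w c e : R).
Hypothesis Hwc : admissible w c.
Hypothesis He : alpha0 w c < e < alpha1 w c.
Let e1 := eta1 w c e.
Let e2 := eta2 w c e.

(** The upper bound amounts to [eta2 < e]; the lower one, combined with [e < alpha1], yields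
    [eta2 > 0]. They turn into equalities at [alpha0] and at [alpha1] respectively. *)
Lemma Apol_bounds :
  4 * sqrt w - 2 * c < sqrt (Apol w c e) < 3 * e - 4 * c /\
  sqrt (Apol w c e) ^ 2 = Apol w c e.
Proof.
destruct (admissible_sqrt w c Hwc) as (Hw & HW & EW & Hc).
destruct (alpha0_spec w c Hwc) as [P E]. destruct He as [Hl Hu]. unfold alpha1 in Hu.
set (W := sqrt w) in *. set (a := alpha0 w c) in *. clearbody W a.
assert (X : 48 * w + 4 * c ^ 2 < (3 * e - 4 * c) ^ 2) by (rewrite <- E; nra).
assert (Y : (3 * e - 4 * c) ^ 2 < (12 * W + 2 * c) ^ 2) by nra.
assert (EA : 3 * Apol w c e = 16 * c ^ 2 + 192 * w - (3 * e - 4 * c) ^ 2) by (unfold Apol; ring).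
assert (A1 : (4 * W - 2 * c) ^ 2 < Apol w c e) by nra.
assert (A2 : Apol w c e < (3 * e - 4 * c) ^ 2) by nra.
assert (A0 : 0 <= Apol w c e) by (generalize (pow2_ge_0 (4 * W - 2 * c)); lra).
repeat split.
- rewrite <- (sqrt_pow2 (4 * W - 2 * c)) by lra. apply sqrt_lt_1_alt. split; [nra|easy].
- rewrite <- (sqrt_pow2 (3 * e - 4 * c)) by lra. now apply sqrt_lt_1_alt.
- now apply pow2_sqrt.
Qed.

Lemma eta_order : e1 < 0 < e2 /\ e2 < e.
Proof.
destruct (admissible_sqrt w c Hwc) as (Hw & HW & EW & Hc).
destruct Apol_bounds as [[Q1 Q2] EQ]. destruct (alpha0_bounds w c Hwc) as [[P1 P2] P3].
destruct He as [Hl Hu]. unfold alpha1 in *. unfold e1, e2, eta1, eta2.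
set (q := sqrt (Apol w c e)) in *. unfold Apol in EQ.
set (W := sqrt w) in *. set (a := alpha0 w c) in *. clearbody W a q.
assert (0 < (- e + 4 * c + q) / 2) by lra.
(* The product is [(e - 2 c)^2 - 16 w], negative because [|e - 2 c| < 4 sqrt w]. *)
assert (((- e + 4 * c - q) / 2) * ((- e + 4 * c + q) / 2) < 0).
{ replace (((- e + 4 * c - q) / 2) * ((- e + 4 * c + q) / 2))
    with (((- e + 4 * c) ^ 2 - q ^ 2) / 4) by field. rewrite EQ, <- EW. nra. }
repeat split; nra.
Qed.

(** Vieta's relations, here and in [eta_pairs]: the sum of the roots recovers [c], the sum of pairs
    recovers the coefficient [w - c^2/4] of the profile equation. *)
Lemma eta_sum : e1 + e2 + e = 4 * c.
Proof. unfold e1, e2, eta1, eta2. field. Qed.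

Lemma eta_pairs : e1 * e2 + e * (e1 + e2) = 4 * c ^ 2 - 16 * w.
Proof.
destruct Apol_bounds as [_ EQ]. unfold e1, e2, eta1, eta2.
set (q := sqrt (Apol w c e)) in *. unfold Apol in EQ. nra.
Qed.

Lemma kmod_sqr :
  kmod w c e ^ 2 = ksq w c e /\ 0 < ksq w c e < 1 /\
  1 - ksq w c e = e2 * (e - e1) / (e * (e2 - e1)).
Proof.
destruct eta_order as [[H1 H2] H3].
assert (D : 0 < e * (e2 - e1)) by nra.
assert (E : 1 - ksq w c e = e2 * (e - e1) / (e * (e2 - e1))).
{ unfold ksq. fold e1 e2. field. split; lra. }
assert (P : 0 < e2 * (e - e1) / (e * (e2 - e1))) by (apply Rdiv_lt_0_compat; nra).
assert (P' : 0 < ksq w c e) by (unfold ksq; fold e1 e2; apply Rdiv_lt_0_compat; nra).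
unfold kmod. rewrite pow2_sqrt by lra. repeat split; lra.
Qed.

Lemma gpar_pos : 0 < gpar w c e.
Proof.
destruct eta_order as [[H1 H2] H3]. unfold gpar. fold e1 e2.
apply Rdiv_lt_0_compat; [lra|]. apply sqrt_lt_R0. nra.
Qed.

(** In [g / sqrt (1 - k^2)] the factor [e (eta2 - eta1)] cancels, and only [eta2 (e - eta1)]
    remains. *)
Lemma Tper_upper : Tper w c e <= 4 * PI / sqrt (e2 * (e - e1)).
Proof.
destruct eta_order as [[H1 H2] H3]. destruct kmod_sqr as (E & [K0 K1] & E').
unfold Tper, gpar. fold e1 e2.
assert (HK := EllK_upper (kmod w c e)). rewrite E in HK. specialize (HK K1).
rewrite E', sqrt_div_alt in HK by nra.
assert (P : 0 < sqrt (e2 * (e - e1))) by (apply sqrt_lt_R0; nra).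
assert (Q : 0 < sqrt (e * (e2 - e1))) by (apply sqrt_lt_R0; nra).
set (p := sqrt (e2 * (e - e1))) in *. set (q := sqrt (e * (e2 - e1))) in *.
apply Rle_trans with (4 * (2 / q) * (PI / 2 / (p / q))).
- apply Rmult_le_compat_l; [|easy]. apply Rmult_le_pos; [lra|]. apply Rdiv_le_0_compat; lra.
- apply Req_le. field. lra.
Qed.

(** Near [alpha1] the logarithm diverges because [eta2] tends to 0. The prefactor uses a fixed bound
    [Q] so as to cover the case [w = c^2/4] too: there [eta2 - eta1] also tends to 0, [k^2] tends to
    1/2, and the period grows through [g] while [K] stays bounded. *)
Lemma Tper_lower (Q : R) :
  sqrt (e * (e2 - e1)) <= Q ->
  8 / Q * ln (1 + PI / 2 * Q / sqrt (e2 * (e - e1))) <= Tper w c e.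
Proof.
intros HQ.
destruct eta_order as [[H1 H2] H3]. destruct kmod_sqr as (E & [K0 K1] & E').
unfold Tper, gpar. fold e1 e2.
assert (P : 0 < sqrt (e2 * (e - e1))) by (apply sqrt_lt_R0; nra).
assert (P' : 0 < sqrt (e * (e2 - e1))) by (apply sqrt_lt_R0; nra).
assert (EP : sqrt (e2 * (e - e1)) ^ 2 = e2 * (e - e1)) by (apply pow2_sqrt; nra).
assert (EQ : sqrt (e * (e2 - e1)) ^ 2 = e * (e2 - e1)) by (apply pow2_sqrt; nra).
assert (HK := EllK_lower (kmod w c e) _ _ Q P (conj P' HQ)).
rewrite E, E', EP, EQ in HK.
assert (HK' := HK ltac:(field; split; lra)). clear HK.
set (p := sqrt (e2 * (e - e1))) in *. set (q := sqrt (e * (e2 - e1))) in *.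
apply Rle_trans with (4 * (2 / q) * (q / Q * ln (1 + PI / 2 * Q / p))).
- apply Req_le. field. lra.
- apply Rmult_le_compat_l; [|easy]. apply Rmult_le_pos; [lra|]. apply Rdiv_le_0_compat; lra.
Qed.

(* [e2 (e - e1) >= - e1 e2 = (alpha1 - e) (e - 2 c + 4 sqrt w)]. *)
Lemma gap_le_of_Tper (L : R) :
  0 < L -> Tper w c e = 2 * L ->
  (alpha1 w c - e) * (alpha0 w c - 2 * c + 4 * sqrt w) <= 4 * PI ^ 2 / L ^ 2.
Proof.
intros HL HT. assert (H := Tper_upper). rewrite HT in H.
destruct (admissible_sqrt w c Hwc) as (Hw & HW & EW & Hc).
destruct eta_order as [[H1 H2] H3]. assert (S := eta_sum). assert (S2 := eta_pairs).
destruct (alpha0_bounds w c Hwc) as [[P1 P2] P3]. destruct He as [Hl Hu].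
assert (P : 0 < sqrt (e2 * (e - e1))) by (apply sqrt_lt_R0; nra).
assert (EP : sqrt (e2 * (e - e1)) ^ 2 = e2 * (e - e1)) by (apply pow2_sqrt; nra).
set (p := sqrt (e2 * (e - e1))) in *.
assert (B : p <= 2 * PI / L).
{ apply Rmult_le_reg_r with (2 * L); [lra|].
  replace (2 * PI / L * (2 * L)) with (4 * PI) by (field; lra).
  apply Rmult_le_reg_r with (/ p); [now apply Rinv_0_lt_compat|].
  replace (p * (2 * L) * / p) with (2 * L) by (field; lra). exact H. }
apply Rle_trans with (p ^ 2).
- rewrite EP. unfold alpha1 in *.
  apply Rle_trans with ((4 * sqrt w + 2 * c - e) * (e - 2 * c + 4 * sqrt w)).
  + apply Rmult_le_compat_l; lra.
  + replace ((4 * sqrt w + 2 * c - e) * (e - 2 * c + 4 * sqrt w))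
      with (16 * sqrt w ^ 2 - (e - 2 * c) ^ 2) by ring.
    rewrite EW. nra.
- replace (4 * PI ^ 2 / L ^ 2) with ((2 * PI / L) ^ 2) by (field; lra).
  apply pow_incr; lra.
Qed.

End Roots.

(** * Existence and limit of [eta3L] *)

Lemma eta_continuous (w c x : R) :
  continuous (eta1 w c) x /\ continuous (eta2 w c) x.
Proof.
assert (P : continuous (fun e => - e + 4 * c) x).
{ apply (ex_derive_continuous (fun e => - e + 4 * c)). now auto_derive. }
assert (S : continuous (fun e => sqrt (Apol w c e)) x).
{ apply continuous_sqrt_comp. apply (ex_derive_continuous (Apol w c)).
  unfold Apol. now auto_derive. }
split; unfold eta1, eta2, Rdiv.
- apply (continuous_mult (fun e => - e + 4 * c - sqrt (Apol w c e)) (fun _ => / 2));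
    [|apply continuous_const].
  now apply (continuous_minus (fun e => - e + 4 * c) (fun e => sqrt (Apol w c e))).
- apply (continuous_mult (fun e => - e + 4 * c + sqrt (Apol w c e)) (fun _ => / 2));
    [|apply continuous_const].
  now apply (continuous_plus (fun e => - e + 4 * c) (fun e => sqrt (Apol w c e))).
Qed.

Lemma continuous_eps (f : R -> R) (x eps : R) :
  continuous f x -> 0 < eps ->
  exists d, 0 < d /\ forall y, Rabs (y - x) < d -> Rabs (f y - f x) < eps.
Proof.
intros Hf He. destruct (proj1 (filterlim_locally f (f x)) Hf (mkposreal eps He)) as [d Hd].
exists d. split; [apply cond_pos|]. intros y Hy. apply Hd. exact Hy.
Qed.

Lemma continuous_of_eps (f : R -> R) (x : R) :
  (forall eps, 0 < eps -> exists d, 0 < d /\ forall y, Rabs (y - x) < d -> Rabs (f y - f x) < eps) ->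
  continuous f x.
Proof.
intros H. apply (proj2 (filterlim_locally f (f x))). intros eps.
destruct (H eps (cond_pos eps)) as (d & Hd & Hf).
exists (mkposreal d Hd). intros y Hy. apply Hf. exact Hy.
Qed.

Lemma EllK_sqrt_continuous (m : R) :
  0 < m < 1 -> continuous (fun x => EllK (sqrt x)) m.
Proof.
intros Hm. apply continuous_of_eps. intros eps Heps.
(* For [|y - m| < (1 - m) / 2] both [1 - m] and [1 - y] are at least [d ^ 2], so [EllK_lipschitz]
   applies with the constant [M]. The entry [m] of the minimum keeps [y] positive, hence
   [sqrt y ^ 2 = y]. *)
set (d := sqrt ((1 - m) / 2)).
assert (Hd : 0 < d) by (apply sqrt_lt_R0; lra).
assert (Ed : d ^ 2 = (1 - m) / 2) by (apply pow2_sqrt; lra).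
set (M := PI / 2 / (2 * d ^ 3)).
assert (HM : 0 < M).
{ generalize PI_RGT_0 (pow_lt d 3 Hd). intros. apply Rdiv_lt_0_compat; lra. }
exists (Rmin m (Rmin ((1 - m) / 2) (eps / M))). split.
{ repeat apply Rmin_glb_lt; try lra. now apply Rdiv_lt_0_compat. }
intros y Hy.
assert (H1 := Rlt_le_trans _ _ _ Hy (Rmin_l _ _)).
assert (H2 := Rlt_le_trans _ _ _ (Rlt_le_trans _ _ _ Hy (Rmin_r _ _)) (Rmin_l _ _)).
assert (H3 := Rlt_le_trans _ _ _ (Rlt_le_trans _ _ _ Hy (Rmin_r _ _)) (Rmin_r _ _)).
apply Rabs_def2 in H1. apply Rabs_def2 in H2.
assert (Ey : sqrt y ^ 2 = y) by (apply pow2_sqrt; lra).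
assert (Em : sqrt m ^ 2 = m) by (apply pow2_sqrt; lra).
eapply Rle_lt_trans.
- apply (EllK_lipschitz _ _ d); rewrite ?Ey, ?Em, ?Ed; lra.
- rewrite Ey, Em.
  replace (PI / 2 * (Rabs (y - m) / (2 * d ^ 3))) with (Rabs (y - m) * M)
    by (unfold M, Rdiv; ring).
  apply Rmult_lt_reg_r with (/ M); [now apply Rinv_0_lt_compat|].
  rewrite Rmult_assoc, Rinv_r, Rmult_1_r by lra. exact H3.
Qed.

Lemma Tper_continuous (w c e : R) :
  admissible w c -> alpha0 w c < e < alpha1 w c -> continuous (Tper w c) e.
Proof.
intros Hwc He.
destruct (eta_order w c e Hwc He) as [[H1 H2] H3].
destruct (kmod_sqr w c e Hwc He) as (E & K & _).
destruct (eta_continuous w c e) as [C1 C2].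
assert (Cid : continuous (fun x : R => x) e) by apply continuous_id.
assert (D : continuous (fun x => x * (eta2 w c x - eta1 w c x)) e).
{ apply (continuous_mult (fun x => x) (fun x => eta2 w c x - eta1 w c x)); [easy|].
  now apply (continuous_minus (eta2 w c) (eta1 w c)). }
unfold Tper.
apply (continuous_mult (fun x => 4 * gpar w c x) (fun x => EllK (kmod w c x))).
- apply (continuous_mult (fun _ => 4) (gpar w c)); [apply continuous_const|].
  unfold gpar, Rdiv.
  apply (continuous_mult (fun _ => 2)); [apply continuous_const|].
  apply continuous_Rinv_comp.
  + now apply continuous_sqrt_comp.
  + apply Rgt_not_eq, sqrt_lt_R0. nra.
- unfold kmod.
  apply (continuous_comp (ksq w c) (fun x => EllK (sqrt x))).
  + unfold ksq, Rdiv.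
    apply (continuous_mult (fun x => - eta1 w c x * (x - eta2 w c x))).
    * apply (continuous_mult (fun x => - eta1 w c x) (fun x => x - eta2 w c x)).
      -- now apply (continuous_opp (eta1 w c)).
      -- now apply (continuous_minus (fun x => x) (eta2 w c)).
    * apply continuous_Rinv_comp; [easy|]. nra.
  + now apply EllK_sqrt_continuous.
Qed.

Lemma Tper_unbounded (w c e0 B : R) :
  admissible w c -> alpha0 w c < e0 < alpha1 w c ->
  exists e, e0 < e < alpha1 w c /\ B < Tper w c e.
Proof.
intros Hwc He0.
destruct (admissible_sqrt w c Hwc) as (Hw & HW & EW & Hc).
destruct (alpha0_bounds w c Hwc) as [[P1 P2] _].
set (p := fun x => sqrt (eta2 w c x * (x - eta1 w c x))).
assert (Cp : continuous p (alpha1 w c)).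
{ apply continuous_sqrt_comp. destruct (eta_continuous w c (alpha1 w c)) as [C1 C2].
  apply (continuous_mult (eta2 w c) (fun x => x - eta1 w c x)); [easy|].
  apply (continuous_minus (fun x => x) (eta1 w c)); [apply continuous_id|easy]. }
assert (p0 : p (alpha1 w c) = 0).
{ unfold p. replace (eta2 w c (alpha1 w c)) with 0; [now rewrite Rmult_0_l, sqrt_0|].
  unfold eta2. replace (Apol w c (alpha1 w c)) with ((4 * sqrt w - 2 * c) ^ 2).
  - rewrite sqrt_pow2 by lra. unfold alpha1. field.
  - unfold Apol, alpha1. rewrite <- EW at 4. ring. }
(* On the whole interval [eta2 - eta1 = sqrt (Apol e) < 3 e - 4 c], so [e (eta2 - eta1)] is below
   its bound at [alpha1]. *)
set (Q := sqrt (alpha1 w c * (3 * alpha1 w c - 4 * c))).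
assert (HQ : 0 < Q).
{ apply sqrt_lt_R0. unfold alpha1 in *. nra. }
(* [X] solves [8 / Q * ln X = Rmax B 0]; it remains to make [p e < PI / 2 * Q / X]. *)
set (X := exp (Rmax B 0 * Q / 8)).
assert (HX : 0 < X) by apply exp_pos.
destruct (continuous_eps p (alpha1 w c) (PI / 2 * Q / X) Cp) as (d & Hd & Hp).
{ generalize PI_RGT_0. intros. apply Rdiv_lt_0_compat; nra. }
exists (Rmax ((e0 + alpha1 w c) / 2) (alpha1 w c - d / 2)).
set (e := Rmax _ _).
assert (Ee : (e0 + alpha1 w c) / 2 <= e /\ alpha1 w c - d / 2 <= e < alpha1 w c).
{ unfold e. split; [apply Rmax_l|split; [apply Rmax_r|]]. apply Rmax_lub_lt; lra. }
assert (He : alpha0 w c < e < alpha1 w c) by lra.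
split; [lra|].
destruct (eta_order w c e Hwc He) as [[H1 H2] H3].
destruct (Apol_bounds w c e Hwc He) as [[Q1 Q2] _].
eapply Rlt_le_trans; [|apply (Tper_lower w c e Hwc He Q)].
- assert (Hpe : 0 < p e) by (apply sqrt_lt_R0; nra).
  assert (Hpx : p e < PI / 2 * Q / X).
  { specialize (Hp e). rewrite p0, Rminus_0_r in Hp.
    rewrite <- (Rabs_right (p e)) by lra. apply Hp.
    rewrite Rabs_left; lra. }
  fold (p e).
  assert (L : Rmax B 0 * Q / 8 < ln (1 + PI / 2 * Q / p e)).
  { rewrite <- (ln_exp (Rmax B 0 * Q / 8)). fold X. apply ln_increasing; [easy|].
    assert (X < PI / 2 * Q / p e); [|lra].
    apply Rmult_lt_reg_r with (p e / X); [now apply Rdiv_lt_0_compat|].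
    replace (X * (p e / X)) with (p e) by (field; lra).
    replace (PI / 2 * Q / p e * (p e / X)) with (PI / 2 * Q / X) by (field; lra).
    easy. }
  apply Rle_lt_trans with (8 / Q * (Rmax B 0 * Q / 8)).
  + replace (8 / Q * (Rmax B 0 * Q / 8)) with (Rmax B 0) by (field; lra). apply Rmax_l.
  + apply Rmult_lt_compat_l; [apply Rdiv_lt_0_compat; lra|easy].
- apply sqrt_le_1_alt. replace (eta2 w c e - eta1 w c e) with (sqrt (Apol w c e))
    by (unfold eta1, eta2; field).
  apply Rmult_le_compat; try lra.
Qed.

(** [epsilon] yields the equation only if it has a solution. The bound [M] puts [2 * L] above the
    period at the midpoint [e0], and the period exceeds [2 * L] somewhere to the right of [e0]; the
    intermediate value theorem does the rest. *)
Lemma eta3L_spec (w c : R) :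
  admissible w c ->
  exists M, 0 < M /\ forall L, M <= L ->
    alpha0 w c < eta3L w c L < alpha1 w c /\ Tper w c (eta3L w c L) = 2 * L.
Proof.
intros Hwc. destruct (alpha0_bounds w c Hwc) as [[P1 P2] _].
set (e0 := (alpha0 w c + alpha1 w c) / 2).
assert (He0 : alpha0 w c < e0 < alpha1 w c) by (unfold e0; lra).
exists (Rmax 0 (Tper w c e0) + 1). split; [generalize (Rmax_l 0 (Tper w c e0)); lra|].
intros L HL. generalize (Rmax_l 0 (Tper w c e0)) (Rmax_r 0 (Tper w c e0)). intros M1 M2.
apply (epsilon_spec (inhabits 0) (fun e => alpha0 w c < e < alpha1 w c /\ Tper w c e = 2 * L)).
destruct (Tper_unbounded w c e0 (2 * L) Hwc He0) as (b & Hb & HT).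
destruct (IVT_interv (fun e => Tper w c e - 2 * L) e0 b) as (z & Hz & E); try lra.
- intros a Ha. apply continuity_pt_filterlim.
  apply (continuous_minus (Tper w c) (fun _ => 2 * L)).
  + apply Tper_continuous; [easy|lra].
  + apply continuous_const.
- exists z. split; lra.
Qed.

Lemma eta3L_lim (w c eps : R) :
  admissible w c -> 0 < eps ->
  exists M, 0 < M /\ forall L, M <= L ->
    alpha0 w c < eta3L w c L < alpha1 w c /\ Tper w c (eta3L w c L) = 2 * L /\
    alpha1 w c - eta3L w c L < eps.
Proof.
intros Hwc Heps. destruct (eta3L_spec w c Hwc) as (M & HM & H).
destruct (alpha0_bounds w c Hwc) as [_ P3].
set (k := alpha0 w c - 2 * c + 4 * sqrt w) in *.
assert (HP := PI_RGT_0).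
assert (Hk : 0 < 4 * PI ^ 2 / (k * eps)) by (apply Rdiv_lt_0_compat; nra).
(* [N] is the length at which the bound [4 PI^2 / L^2] of [gap_le_of_Tper] equals [k * eps]. *)
set (N := sqrt (4 * PI ^ 2 / (k * eps))).
assert (HN : 0 < N) by now apply sqrt_lt_R0.
assert (EN : N ^ 2 = 4 * PI ^ 2 / (k * eps)) by (apply pow2_sqrt; lra).
exists (M + N + 1). split; [lra|]. intros L HL.
destruct (H L) as [He HT]; [lra|]. repeat split; try easy.
assert (G := gap_le_of_Tper w c _ Hwc He L ltac:(lra) HT). fold k in G.
apply Rmult_lt_reg_r with k; [easy|].
eapply Rle_lt_trans; [exact G|].
apply Rmult_lt_reg_r with (L ^ 2); [nra|].
replace (4 * PI ^ 2 / L ^ 2 * L ^ 2) with (eps * k * (4 * PI ^ 2 / (k * eps))) by (field; lra).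
rewrite <- EN. apply Rmult_lt_compat_l; nra.
Qed.

(** * Wave profiles *)

Definition force (w c u : R) : R := (w - c ^ 2 / 4) * u + c / 2 * u ^ 3 - 3 / 16 * u ^ 5.

(* In [wave_s_slope], [s] stands for [sqrt (F^2 - r)], [r] being the minimum of [F^2] ([0] for the
   solitary wave); this function stays smooth at the point where [F^2] attains [r]. *)
Record wave (w c e L : R) (F dF s ds : R -> R) : Prop := {
  wave_derive : forall x, is_derive F x (dF x);
  wave_force : forall x, is_derive dF x (force w c (F x));
  wave_range : forall x, 0 < F x <= sqrt e;
  wave_top : F 0 = sqrt e;
  wave_slope_0 : dF 0 = 0;
  wave_even : forall x, F (- x) = F x;
  wave_decr : forall x, 0 <= x <= L -> dF x <= 0;
  wave_s_derive : forall x, is_derive s x (ds x);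
  wave_s_range : forall x, 0 <= x <= L -> 0 <= s x <= F x;
  wave_s_slope : forall x, 0 <= x <= L -> ds x <= - (F x ^ 2 * sqrt (e - F x ^ 2) / 4) }.

Lemma neg_le_of_sqr_ge (u y : R) : u <= 0 -> 0 <= y -> y ^ 2 <= u ^ 2 -> u <= - y.
Proof. intros. nra. Qed.

(** [F] decreases on [[r, L]], so [sqrt (e - F^2)] is there at least its value [k] at [r]. Then
    [wave_s_slope] gives [F^2 <= - (4 / k) s'], whose integral is at most [(4 / k) s(r)], and
    [s(r) <= F r]. *)
Lemma wave_tail (w c e L : R) (F dF s ds : R -> R) (r : R) :
  wave w c e L F dF s ds -> 0 <= r <= L -> F r ^ 2 < e ->
  RInt (fun x => F x ^ 2) r L <= 4 * F r / sqrt (e - F r ^ 2).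
Proof.
intros W Hr Hlt.
set (k := sqrt (e - F r ^ 2)).
assert (Hk : 0 < k) by (apply sqrt_lt_R0; lra).
apply Rle_trans with ((- (4 / k)) * s L - (- (4 / k)) * s r).
- apply (RInt_le_increment _ (fun x => - (4 / k) * s x) (fun x => - (4 / k) * ds x)).
  + lra.
  + intros x. apply (ex_derive_continuous (fun x => F x ^ 2)).
    assert (D := wave_derive _ _ _ _ _ _ _ _ W x).
    auto_derive. now exists (dF x).
  + intros x Hx. apply is_derive_scal. apply (wave_s_derive _ _ _ _ _ _ _ _ W).
  + intros x Hx.
    assert (S := wave_s_slope _ _ _ _ _ _ _ _ W x ltac:(lra)).
    assert (M : F x <= F r).
    { assert (- F r <= - F x); [|lra].
      apply (derive_nonneg_incr (fun x => - F x) (fun x => - dF x)); try lra.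
      - intros y Hy. apply (is_derive_opp F). apply (wave_derive _ _ _ _ _ _ _ _ W).
      - intros y Hy. generalize (wave_decr _ _ _ _ _ _ _ _ W y ltac:(lra)). lra. }
    assert (P := wave_range _ _ _ _ _ _ _ _ W x).
    assert (K : k <= sqrt (e - F x ^ 2)) by (apply sqrt_le_1_alt; nra).
    set (k' := sqrt (e - F x ^ 2)) in *.
    apply Rle_trans with (4 / k * (F x ^ 2 * k / 4)).
    * apply Req_le. field. lra.
    * rewrite <- Ropp_mult_distr_l, Ropp_mult_distr_r.
      apply Rmult_le_compat_l; [apply Rdiv_le_0_compat; lra|].
      assert (F x ^ 2 * k <= F x ^ 2 * k') by (apply Rmult_le_compat_l; [apply pow2_ge_0|easy]).
      lra.
- assert (S1 := wave_s_range _ _ _ _ _ _ _ _ W L ltac:(lra)).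
  assert (S2 := wave_s_range _ _ _ _ _ _ _ _ W r ltac:(lra)).
  apply Rmult_le_reg_r with k; [easy|].
  replace ((- (4 / k) * s L - - (4 / k) * s r) * k) with (4 * (s r - s L)) by (field; lra).
  replace (4 * F r / k * k) with (4 * F r) by (field; lra). lra.
Qed.

(* [h = 1/F^2] turns the solitary wave equation into the linear one [h'' = (4 w - c^2) h + c/2]. *)
Lemma wave_of_reciprocal (w c L : R) (F h dh : R -> R) :
  admissible w c ->
  (forall x, F x = / sqrt (h x)) ->
  (forall x, is_derive h x (dh x)) ->
  (forall x, is_derive dh x ((4 * w - c ^ 2) * h x + c / 2)) ->
  (forall x, dh x ^ 2 = (4 * w - c ^ 2) * h x ^ 2 + c * h x - 1 / 4) ->
  h 0 = / alpha1 w c -> (forall x, h 0 <= h x) -> dh 0 = 0 ->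
  (forall x, h (- x) = h x) -> (forall x, 0 <= x -> 0 <= dh x) ->
  let dF := fun x => - dh x / (2 * sqrt (h x) ^ 3) in
  wave w c (alpha1 w c) L F dF F dF.
Proof.
intros Hwc HF Hh Hdh Hsq H0 Hmin Hd0 Hev Hpos dF.
destruct (alpha0_bounds w c Hwc) as [[P1 P2] _].
destruct (admissible_sqrt w c Hwc) as (Hw & HW & EW & Hc).
assert (Ha : 0 < alpha1 w c) by lra.
assert (h0 : 0 < h 0) by (rewrite H0; now apply Rinv_0_lt_compat).
assert (hp : forall x, 0 < h x) by (intros x; specialize (Hmin x); lra).
assert (rp : forall x, 0 < sqrt (h x)) by (intros x; now apply sqrt_lt_R0).
assert (er : forall x, sqrt (h x) ^ 2 = h x) by (intros x; apply pow2_sqrt; specialize (hp x); lra).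
assert (dr : forall x, is_derive (fun x => sqrt (h x)) x (dh x / (2 * sqrt (h x)))).
{ intros x. now apply is_derive_sqrt. }
set (r := fun x => sqrt (h x)) in *.
assert (D1 : forall x, is_derive F x (dF x)).
{ intros x. apply (is_derive_ext (fun x => / r x)); [intros; now rewrite HF|].
  evar_last.
  - apply is_derive_inv; [apply dr|]. apply Rgt_not_eq, rp.
  - unfold dF. fold (r x). specialize (rp x). fold (r x) in *. field. lra. }
assert (decr : forall x, 0 <= x -> dF x <= 0).
{ intros x Hx. unfold dF. fold (r x). specialize (rp x). fold (r x) in rp.
  specialize (Hpos x Hx).
  assert (0 <= dh x / (2 * r x ^ 3)).
  { apply Rdiv_le_0_compat; [easy|]. generalize (pow_lt (r x) 3 rp); lra. }
  unfold Rdiv in *. lra. }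
assert (F2 : forall x, F x ^ 2 = / h x).
{ intros x. rewrite HF, pow_inv. now rewrite er. }
assert (rng : forall x, 0 < F x <= sqrt (alpha1 w c)).
{ intros x. rewrite HF. split; [now apply Rinv_0_lt_compat|].
  rewrite <- (Rinv_inv (alpha1 w c)), <- H0, sqrt_inv.
  apply Rinv_le_contravar; [apply rp|]. now apply sqrt_le_1_alt. }
split; try easy.
- intros x. specialize (rp x). specialize (er x). fold (r x) in *.
  evar_last.
  + apply (is_derive_div (fun x => - dh x) (fun x => 2 * r x ^ 3)).
    * apply (is_derive_opp dh). apply Hdh.
    * apply is_derive_scal. apply is_derive_pow. apply dr.
    * generalize (pow_lt (r x) 3 rp); lra.
  + unfold force. rewrite HF. fold (r x).
    unfold opp, minus, plus; simpl.
    specialize (Hsq x). fold (r x).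
    set (d := dh x) in *. set (y := r x) in *. rewrite <- er in Hsq |- *.
    transitivity ((- ((4 * w - c ^ 2) * y ^ 2 + c / 2) * 2 * y ^ 2 + 3 * d ^ 2) / (4 * y ^ 5)).
    { field. lra. }
    rewrite Hsq. field. lra.
- rewrite HF, H0, sqrt_inv. now rewrite Rinv_inv.
- unfold dF. rewrite Hd0. unfold Rdiv. ring.
- intros x. now rewrite !HF, Hev.
- intros x [Hx _]. now apply decr.
- intros x _. generalize (rng x). lra.
- intros x [Hx _].
  apply neg_le_of_sqr_ge; [now apply decr| |].
  + apply Rdiv_le_0_compat; [|lra]. apply Rmult_le_pos; [apply pow2_ge_0|apply sqrt_pos].
  + assert (X : 0 <= alpha1 w c - F x ^ 2).
    { rewrite F2. assert (/ h x <= / h 0) by (apply Rinv_le_contravar; [easy|apply Hmin]).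
      rewrite H0, Rinv_inv in H. lra. }
    replace ((F x ^ 2 * sqrt (alpha1 w c - F x ^ 2) / 4) ^ 2)
      with ((F x ^ 2) ^ 2 * sqrt (alpha1 w c - F x ^ 2) ^ 2 / 16) by field.
    rewrite pow2_sqrt by easy. rewrite F2.
    unfold dF. specialize (rp x). specialize (er x). fold (r x) in *.
    replace ((- dh x / (2 * r x ^ 3)) ^ 2) with (dh x ^ 2 / (4 * (r x ^ 2) ^ 3)) by (field; lra).
    rewrite er, Hsq. specialize (hp x).
    (* The squared inequality reduces to [alpha1 <= 4 (4 w - c^2) h + 4 c], an equality at the
       crest, where [h] is minimal. *)
    assert (Y : 4 * sqrt w - 2 * c <= 4 * (4 * w - c ^ 2) * h x).
    { apply Rle_trans with (4 * (4 * w - c ^ 2) * h 0).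
      - rewrite H0. unfold alpha1 in *. apply Req_le.
        rewrite <- EW at 2. field. lra.
      - apply Rmult_le_compat_l; [nra|apply Hmin]. }
    apply Rmult_le_reg_r with (16 * h x ^ 3); [generalize (pow_lt (h x) 3 hp); lra|].
    replace ((/ h x) ^ 2 * (alpha1 w c - / h x) / 16 * (16 * h x ^ 3))
      with (alpha1 w c * h x - 1) by (field; lra).
    replace (((4 * w - c ^ 2) * h x ^ 2 + c * h x - 1 / 4) / (4 * h x ^ 3) * (16 * h x ^ 3))
      with (4 * (4 * w - c ^ 2) * h x * h x + 4 * c * h x - 1) by (field; lra).
    unfold alpha1 in *. nra.
Qed.

Lemma cosh_sinh_sqr (y : R) : cosh y ^ 2 - sinh y ^ 2 = 1.
Proof.
unfold cosh, sinh. assert (E : exp y * exp (- y) = 1) by (rewrite <- exp_plus, Rplus_opp_r; apply exp_0).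
simpl. lra.
Qed.

Lemma cosh_lower (y : R) : 1 <= cosh y /\ (1 + y) / 2 <= cosh y.
Proof.
generalize (cosh_sinh_sqr y) (exp_pos y) (exp_pos (- y)) (exp_ineq1_le y).
unfold cosh. intros E P Q I. split; [|lra].
generalize (pow2_ge_0 (sinh y)). unfold cosh in E. nra.
Qed.

Lemma sinh_nonneg (y : R) : 0 <= y -> 0 <= sinh y.
Proof.
intros Hy. unfold sinh. assert (exp (- y) <= exp y); [|lra].
destruct Hy as [Hy| <-]; [left; apply exp_increasing; lra|]. rewrite Ropp_0. lra.
Qed.

Lemma inv_sqrt_decay (F h : R -> R) :
  (forall x, F x = / sqrt (h x)) -> (forall B, exists r, 0 <= r /\ B <= h r) ->
  forall rho, 0 < rho -> exists r, 0 <= r /\ F r <= rho.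
Proof.
intros HF Hh rho Hrho. destruct (Hh (/ rho ^ 2)) as (r & Hr & HB). exists r. split; [easy|].
assert (P : 0 < / rho) by now apply Rinv_0_lt_compat.
rewrite HF, <- (Rinv_inv rho). apply Rinv_le_contravar; [easy|].
rewrite <- (sqrt_pow2 (/ rho)) by lra. apply sqrt_le_1_alt. now rewrite pow_inv.
Qed.

(** The reciprocal of [Phi^2] is an affine function of [cosh (mu x)] for [w > c^2/4] and a quadratic
    polynomial for [w = c^2/4]. Smallness at a single point [r] is enough, since the profile
    decreases beyond it. *)
Lemma Phi_wave (w c : R) :
  admissible w c ->
  exists dF, (forall L, wave w c (alpha1 w c) L (Phi w c) dF (Phi w c) dF) /\
    forall rho, 0 < rho -> exists r, 0 <= r /\ Phi w c r <= rho.
Proof.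
intros Hwc. destruct (admissible_sqrt w c Hwc) as (Hw & HW & EW & Hc).
destruct (Rlt_dec (c ^ 2 / 4) w) as [Hlt|Hge].
- set (mu := sqrt (4 * w - c ^ 2)).
  assert (Hmu : 0 < mu) by (apply sqrt_lt_R0; lra).
  assert (Emu : mu ^ 2 = 4 * w - c ^ 2) by (apply pow2_sqrt; lra).
  assert (Hc2 : c < 2 * sqrt w) by nra.
  set (h := fun x => (sqrt w * cosh (mu * x) - c / 2) / mu ^ 2).
  set (dh := fun x => sqrt w * sinh (mu * x) / mu).
  assert (hp : forall x, 0 < sqrt w * cosh (mu * x) - c / 2).
  { intros x. destruct (cosh_lower (mu * x)) as [H _]. nra. }
  assert (HF : forall x, Phi w c x = / sqrt (h x)).
  { intros x. unfold Phi. destruct (Rlt_dec (c ^ 2 / 4) w) as [_|n]; [|easy].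
    fold mu. rewrite <- sqrt_inv. f_equal. unfold h. rewrite <- Emu. specialize (hp x).
    field. repeat split; lra. }
  assert (dl : forall x, is_derive (fun x => mu * x) x mu).
  { intros x. auto_derive; [easy|ring]. }
  assert (dC : forall x, is_derive (fun x => cosh (mu * x)) x (mu * sinh (mu * x))).
  { intros x. apply (is_derive_comp cosh (fun x => mu * x)); [|apply dl].
    apply is_derive_Reals, derivable_pt_lim_cosh. }
  assert (dS : forall x, is_derive (fun x => sinh (mu * x)) x (mu * cosh (mu * x))).
  { intros x. apply (is_derive_comp sinh (fun x => mu * x)); [|apply dl].
    apply is_derive_Reals, derivable_pt_lim_sinh. }
  exists (fun x => - dh x / (2 * sqrt (h x) ^ 3)). split.
  + intros L. apply wave_of_reciprocal; try easy.
    * intros x. apply (is_derive_ext (fun x => sqrt w / mu ^ 2 * cosh (mu * x) - c / 2 / mu ^ 2)).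
      { intros t. unfold h. simpl. field. lra. }
      replace (dh x) with (sqrt w / mu ^ 2 * (mu * sinh (mu * x)) - 0) by (unfold dh; field; lra).
      apply (is_derive_minus (fun x => sqrt w / mu ^ 2 * cosh (mu * x)) (fun _ => c / 2 / mu ^ 2)).
      -- now apply is_derive_scal.
      -- apply (is_derive_const (c / 2 / mu ^ 2)).
    * intros x. apply (is_derive_ext (fun x => sqrt w / mu * sinh (mu * x))).
      { intros t. unfold dh. simpl. field. lra. }
      replace ((4 * w - c ^ 2) * h x + c / 2) with (sqrt w / mu * (mu * cosh (mu * x)))
        by (rewrite <- Emu; unfold h; field; lra).
      now apply is_derive_scal.
    * intros x. unfold h, dh. rewrite <- Emu.
      assert (E := cosh_sinh_sqr (mu * x)).
      apply Rmult_eq_reg_r with (mu ^ 2); [|nra].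
      transitivity (sqrt w ^ 2 * (cosh (mu * x) ^ 2 - 1)).
      { rewrite <- E. field. lra. }
      transitivity (sqrt w ^ 2 * cosh (mu * x) ^ 2 - c ^ 2 / 4 - mu ^ 2 / 4); [|field; lra].
      rewrite EW, Emu. field.
    * unfold h, alpha1. rewrite Rmult_0_r, cosh_0, Emu.
      rewrite <- EW at 2. field. split; nra.
    * intros x. unfold h. rewrite Rmult_0_r, cosh_0.
      destruct (cosh_lower (mu * x)) as [H _].
      apply Rmult_le_compat_r; [left; apply Rinv_0_lt_compat; nra|]. nra.
    * unfold dh. rewrite Rmult_0_r, sinh_0. unfold Rdiv. ring.
    * intros x. unfold h. replace (mu * - x) with (- (mu * x)) by ring.
      unfold cosh. rewrite Ropp_involutive. now rewrite (Rplus_comm (exp (- _))).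
    * intros x Hx. unfold dh. apply Rdiv_le_0_compat; [|easy].
      apply Rmult_le_pos; [lra|]. apply sinh_nonneg. nra.
  + apply (inv_sqrt_decay _ h HF). intros B.
    (* [y] comes from solving [sqrt w * (y / 2) - c / 2 >= mu^2 B], with [cosh y] replaced by its
       linear lower bound. *)
    set (y := Rmax 0 (2 * (mu ^ 2 * B + c / 2) / sqrt w)).
    assert (Y : 0 <= y) by apply Rmax_l.
    assert (Y2 : 2 * (mu ^ 2 * B + c / 2) / sqrt w <= y) by apply Rmax_r.
    exists (y / mu). split; [now apply Rdiv_le_0_compat|].
    unfold h. replace (mu * (y / mu)) with y by (field; lra).
    destruct (cosh_lower y) as [_ H].
    apply Rmult_le_reg_r with (mu ^ 2); [nra|].
    replace ((sqrt w * cosh y - c / 2) / mu ^ 2 * mu ^ 2) with (sqrt w * cosh y - c / 2) by (field; lra).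
    assert (X : sqrt w * (2 * (mu ^ 2 * B + c / 2) / sqrt w) <= sqrt w * y)
      by (apply Rmult_le_compat_l; lra).
    replace (sqrt w * (2 * (mu ^ 2 * B + c / 2) / sqrt w)) with (2 * (mu ^ 2 * B + c / 2)) in X by (field; lra).
    nra.
- destruct Hwc as [Hwc|[Ew Hc0]]; [easy|].
  assert (EW2 : sqrt w = c / 2).
  { rewrite Ew. replace (c ^ 2 / 4) with ((c / 2) ^ 2) by field. apply sqrt_pow2; lra. }
  set (h := fun x => ((c * x) ^ 2 + 1) / (4 * c)).
  set (dh := fun x => c * x / 2).
  assert (HF : forall x, Phi w c x = / sqrt (h x)).
  { intros x. unfold Phi. destruct (Rlt_dec (c ^ 2 / 4) w) as [n|_]; [easy|].
    rewrite <- sqrt_inv. f_equal. unfold h. field. split; [lra|].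
    generalize (pow2_ge_0 (c * x)). simpl. lra. }
  exists (fun x => - dh x / (2 * sqrt (h x) ^ 3)). split.
  + intros L. apply wave_of_reciprocal; try easy.
    * now right.
    * intros x. unfold h, dh. auto_derive; [easy|]. field. lra.
    * intros x. unfold dh. auto_derive; [easy|]. rewrite Ew. field.
    * intros x. unfold dh, h. rewrite Ew. field. lra.
    * unfold h, alpha1. rewrite EW2. field. lra.
    * intros x. unfold h. apply Rmult_le_compat_r; [left; apply Rinv_0_lt_compat; lra|].
      rewrite Rmult_0_r. generalize (pow2_ge_0 (c * x)). simpl. lra.
    * unfold dh. field.
    * intros x. unfold h. field. lra.
    * intros x Hx. unfold dh. nra.
  + apply (inv_sqrt_decay _ h HF). intros B.
    exists ((4 * c * Rabs B + 1) / c). assert (HB := Rabs_pos B).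
    split; [apply Rdiv_le_0_compat; nra|].
    unfold h. replace (c * ((4 * c * Rabs B + 1) / c)) with (4 * c * Rabs B + 1) by (field; lra).
    apply Rmult_le_reg_r with (4 * c); [lra|].
    replace (((4 * c * Rabs B + 1) ^ 2 + 1) / (4 * c) * (4 * c))
      with ((4 * c * Rabs B + 1) ^ 2 + 1) by (field; lra).
    generalize (Rle_abs B). assert (0 <= c * Rabs B) by nra. nra.
Qed.

(** * The periodic profile, with [S], [C], [D] in the roles of [sn], [cn], [dn] *)

Section JacobiWave.
Variables (w c e L m b rho : R) (F S C D : R -> R).
Let e1 := eta1 w c e.
Let e2 := eta2 w c e.
Hypothesis Hwc : admissible w c.
Hypothesis He : alpha0 w c < e < alpha1 w c.
Hypothesis Hm : m = - e1 * (e - e2) / (e * (e2 - e1)).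
Hypothesis Hb : b = (e - e2) / (e2 - e1).
Hypothesis Hrho : 0 < rho.
Hypothesis Hrho2 : rho ^ 2 = e * (e2 - e1) / 16.
Hypothesis dS : forall x, is_derive S x (rho * C x * D x).
Hypothesis dC : forall x, is_derive C x (- (rho * S x * D x)).
Hypothesis dD : forall x, is_derive D x (- (rho * m * S x * C x)).
Hypothesis SC : forall x, S x ^ 2 + C x ^ 2 = 1.
Hypothesis DS : forall x, D x ^ 2 = 1 - m * S x ^ 2.
Hypothesis Dpos : forall x, 0 < D x.
Hypothesis S0 : S 0 = 0.
Hypothesis D0 : D 0 = 1.
Hypothesis Sodd : forall x, S (- x) = - S x.
Hypothesis Deven : forall x, D (- x) = D x.
Hypothesis SCpos : forall x, 0 <= x <= L -> 0 <= S x /\ 0 <= C x.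
Hypothesis HF : forall x, F x = sqrt e * D x / sqrt (1 + b * S x ^ 2).

Definition jacobi_slope (x : R) : R :=
  - (rho * sqrt e * (m + b) * S x * C x / sqrt (1 + b * S x ^ 2) ^ 3).

(** The choice of [s] comes from [F^2 - e2 = (e - e2) C^2 / (1 + b S^2)], a consequence of
    [e m + e2 b = e - e2]: taking [C] for the root of [C^2] gives a function that changes sign
    smoothly at the trough. *)
Lemma wave_of_jacobi :
  wave w c e L F jacobi_slope
    (fun x => sqrt (e - e2) * C x / sqrt (1 + b * S x ^ 2))
    (fun x => - (rho * sqrt (e - e2) * (1 + b) * S x * D x / sqrt (1 + b * S x ^ 2) ^ 3)).
Proof.
destruct (eta_order w c e Hwc He) as [[H1 H2] H3]. fold e1 e2 in H1, H2, H3.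
assert (Hsum := eta_sum w c e). fold e1 e2 in Hsum.
assert (Hpairs := eta_pairs w c e Hwc He). fold e1 e2 in Hpairs.
assert (b0 : 0 < b) by (rewrite Hb; apply Rdiv_lt_0_compat; lra).
assert (m0 : 0 < m) by (rewrite Hm; apply Rdiv_lt_0_compat; nra).
assert (m1 : m < 1).
{ assert (E : 1 - m = e2 * (e - e1) / (e * (e2 - e1))) by (rewrite Hm; field; lra).
  assert (0 < e2 * (e - e1) / (e * (e2 - e1))) by (apply Rdiv_lt_0_compat; nra). lra. }
assert (re : 0 < sqrt e) by (apply sqrt_lt_R0; lra).
assert (Ere : sqrt e ^ 2 = e) by (apply pow2_sqrt; lra).
assert (rs : 0 < sqrt (e - e2)) by (apply sqrt_lt_R0; lra).
assert (Ers : sqrt (e - e2) ^ 2 = e - e2) by (apply pow2_sqrt; lra).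
assert (Z : forall x, 0 <= S x ^ 2 <= 1).
{ intros x. generalize (SC x) (pow2_ge_0 (S x)) (pow2_ge_0 (C x)). lra. }
assert (N1 : forall x, 1 <= 1 + b * S x ^ 2) by (intros x; specialize (Z x); nra).
assert (EN : forall x, sqrt (1 + b * S x ^ 2) ^ 2 = 1 + b * S x ^ 2).
{ intros x. apply pow2_sqrt. specialize (N1 x). lra. }
assert (NP : forall x, 1 <= sqrt (1 + b * S x ^ 2)).
{ intros x. rewrite <- sqrt_1 at 1. now apply sqrt_le_1_alt. }
set (N := fun x => sqrt (1 + b * S x ^ 2)) in *.
assert (dN : forall x, is_derive N x (b * S x * (rho * C x * D x) / N x)).
{ intros x. evar_last.
  - apply (is_derive_sqrt (fun x => 1 + b * S x ^ 2)); [|specialize (N1 x); lra].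
    apply (is_derive_plus (fun _ => 1)); [apply (is_derive_const 1)|].
    apply is_derive_scal. apply is_derive_pow. apply dS.
  - unfold plus, zero; simpl. change (S x * (S x * 1)) with (S x ^ 2).
    fold (N x). specialize (NP x). fold (N x) in NP. field. lra. }
assert (F2 : forall x, F x ^ 2 = e * (1 - m * S x ^ 2) / (1 + b * S x ^ 2)).
{ intros x. specialize (NP x). rewrite HF. fold (N x) in *.
  transitivity (sqrt e ^ 2 * D x ^ 2 / N x ^ 2); [field; lra|].
  unfold N at 1. now rewrite EN, Ere, DS. }
assert (mb : 0 < m + b) by lra.
unfold jacobi_slope. split.
- intros x. apply (is_derive_ext (fun x => sqrt e * D x / N x)); [intros; now rewrite HF|].
  specialize (NP x). fold (N x) in *.
  evar_last.
  + apply (is_derive_div (fun x => sqrt e * D x) N); [|apply dN|lra].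
    apply is_derive_scal. apply dD.
  + transitivity (- (rho * sqrt e * S x * C x * (m * N x ^ 2 + b * D x ^ 2) / N x ^ 3)); [field; lra|].
    unfold N at 1. rewrite EN, DS. field. lra.
- intros x. specialize (NP x). fold (N x) in *.
  evar_last.
  + apply (is_derive_opp (fun x => rho * sqrt e * (m + b) * S x * C x / N x ^ 3)).
    apply (is_derive_div (fun x => rho * sqrt e * (m + b) * S x * C x) (fun x => N x ^ 3)).
    * apply (is_derive_mult (fun x => rho * sqrt e * (m + b) * S x) C); [|apply dC|exact Rmult_comm].
      apply is_derive_scal. apply dS.
    * apply is_derive_pow. apply dN.
    * generalize (pow_lt (N x) 3 ltac:(lra)); lra.
  + unfold opp, plus, mult; simpl. unfold force. rewrite HF. fold (N x).
    assert (EN' := EN x). fold (N x) in EN'.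
    assert (EC : C x ^ 2 = 1 - S x ^ 2) by (rewrite <- (SC x); ring).
    assert (ED := DS x).
    set (n := N x) in *. set (s := S x) in *. set (d := D x) in *. set (k := C x) in *.
    (* Once [sqrt e * d / n ^ 5] is factored out of both sides, only even powers remain; the
       quadratic relations and Vieta's formulas then leave a rational identity in the roots and
       [s ^ 2]. *)
    transitivity (sqrt e * d / n ^ 5 *
      (- (m + b) * rho ^ 2 * ((k ^ 2 - s ^ 2) * n ^ 2 - 3 * b * s ^ 2 * k ^ 2))).
    { field. lra. }
    transitivity (sqrt e * d / n ^ 5 *
      ((w - c ^ 2 / 4) * (n ^ 2) ^ 2 + c / 2 * sqrt e ^ 2 * d ^ 2 * n ^ 2
       - 3 / 16 * (sqrt e ^ 2) ^ 2 * (d ^ 2) ^ 2)); [f_equal|field; lra].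
    rewrite EN', EC, ED, Ere, Hrho2, Hm, Hb.
    replace (w - c ^ 2 / 4) with (- (e1 * e2 + e * (e1 + e2)) / 16) by lra.
    replace c with ((e1 + e2 + e) / 4) by lra.
    field. lra.
- intros x. specialize (NP x). rewrite HF. fold (N x) in *.
  split; [apply Rdiv_lt_0_compat; [apply Rmult_lt_0_compat; easy|lra]|].
  assert (D x <= 1) by (generalize (DS x) (Dpos x) (Z x); nra).
  apply Rmult_le_reg_r with (N x); [lra|].
  replace (sqrt e * D x / N x * N x) with (sqrt e * D x) by (field; lra).
  apply Rmult_le_compat_l; lra.
- rewrite HF, S0, D0. replace (1 + b * 0 ^ 2) with 1 by ring. rewrite sqrt_1. field.
- rewrite S0. unfold Rdiv. ring.
- intros x. rewrite !HF, Deven, Sodd. now replace ((- S x) ^ 2) with (S x ^ 2) by ring.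
- intros x Hx. destruct (SCpos x Hx) as [Sp Cp]. specialize (NP x). fold (N x) in *.
  assert (0 <= rho * sqrt e * (m + b) * S x * C x / N x ^ 3); [|lra].
  apply Rdiv_le_0_compat; [|apply pow_lt; lra].
  repeat apply Rmult_le_pos; lra.
- intros x. specialize (NP x). fold (N x) in *.
  evar_last.
  + apply (is_derive_div (fun x => sqrt (e - e2) * C x) N); [|apply dN|lra].
    apply is_derive_scal. apply dC.
  + transitivity (- (rho * sqrt (e - e2) * S x * D x * (N x ^ 2 + b * C x ^ 2) / N x ^ 3)); [field; lra|].
    unfold N at 1. rewrite EN. replace (C x ^ 2) with (1 - S x ^ 2) by (rewrite <- (SC x); ring).
    field. lra.
- intros x Hx. destruct (SCpos x Hx) as [Sp Cp]. specialize (NP x). rewrite HF. fold (N x) in *.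
  split; [apply Rdiv_le_0_compat; [apply Rmult_le_pos|]; lra|].
  apply Rmult_le_compat_r; [left; apply Rinv_0_lt_compat; lra|].
  specialize (Dpos x).
  apply Rsqr_incr_0_var; [|apply Rmult_le_pos; lra].
  unfold Rsqr.
  replace (sqrt (e - e2) * C x * (sqrt (e - e2) * C x)) with (sqrt (e - e2) ^ 2 * C x ^ 2) by ring.
  replace (sqrt e * D x * (sqrt e * D x)) with (sqrt e ^ 2 * D x ^ 2) by ring.
  rewrite Ers, Ere, DS. replace (C x ^ 2) with (1 - S x ^ 2) by (rewrite <- (SC x); ring).
  specialize (Z x).
  assert (0 <= e2 * (1 - S x ^ 2)) by (apply Rmult_le_pos; lra).
  assert (0 <= e * (S x ^ 2 * (1 - m))) by (repeat apply Rmult_le_pos; lra).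
  lra.
- intros x Hx. destruct (SCpos x Hx) as [Sp Cp]. specialize (NP x). fold (N x) in *.
  assert (X : e - F x ^ 2 = e * S x ^ 2 * (b + m) / (1 + b * S x ^ 2)).
  { rewrite F2. field. specialize (N1 x). lra. }
  specialize (N1 x). specialize (Z x).
  assert (X0 : 0 <= e - F x ^ 2).
  { rewrite X. apply Rdiv_le_0_compat; [|lra]. repeat apply Rmult_le_pos; lra. }
  apply neg_le_of_sqr_ge.
  + assert (0 <= rho * sqrt (e - e2) * (1 + b) * S x * D x / N x ^ 3); [|lra].
    specialize (Dpos x).
    apply Rdiv_le_0_compat; [|apply pow_lt; lra]. repeat apply Rmult_le_pos; lra.
  + apply Rdiv_le_0_compat; [|lra]. apply Rmult_le_pos; [apply pow2_ge_0|apply sqrt_pos].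
  + replace ((F x ^ 2 * sqrt (e - F x ^ 2) / 4) ^ 2)
      with ((F x ^ 2) ^ 2 * sqrt (e - F x ^ 2) ^ 2 / 16) by field.
    rewrite pow2_sqrt by easy. rewrite X, F2.
    replace ((- (rho * sqrt (e - e2) * (1 + b) * S x * D x / N x ^ 3)) ^ 2)
      with (rho ^ 2 * sqrt (e - e2) ^ 2 * (1 + b) ^ 2 * S x ^ 2 * D x ^ 2 / (N x ^ 2) ^ 3)
      by (field; lra).
    unfold N at 1. rewrite EN, Ers, Hrho2, DS.
    set (z := S x ^ 2) in *.
    apply Rle_trans with ((e ^ 2 * (b + m) * (e * (1 - m * z))) * (z * (1 - m * z) / (16 * (1 + b * z) ^ 3))).
    { apply Req_le. field. lra. }
    apply Rle_trans with ((e * (e2 - e1) * (e - e2) * (1 + b) ^ 2) * (z * (1 - m * z) / (16 * (1 + b * z) ^ 3))).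
    2:{ apply Req_le. field. lra. }
    apply Rmult_le_compat_r.
    { assert (m * z <= 1) by nra.
      apply Rdiv_le_0_compat; [apply Rmult_le_pos; lra|]. generalize (pow_lt (1 + b * z) 3 ltac:(lra)). lra. }
    (* With [z = S x ^ 2] the comparison becomes [e (1 - m z) <= e - e1]. Since [e m + e1 b = 0],
       this is [F^2 <= F^2 - e1] multiplied by [1 + b z]. *)
    replace (e * (e2 - e1) * (e - e2) * (1 + b) ^ 2) with (e ^ 2 * (b + m) * (e - e1))
      by (rewrite Hm, Hb; field; lra).
    assert (0 <= e * (m * z)) by (repeat apply Rmult_le_pos; lra).
    apply Rmult_le_compat_l; [|lra]. repeat apply Rmult_le_pos; lra.
Qed.

End JacobiWave.

(** [4 g K = 2 L] means [K = L / (2 g)], so the amplitude runs from 0 to [PI / 2] on [[0, L]]. Hence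
    [sn] and [cn] are nonnegative there, and [cn] vanishes at [L] and [- L], which kills the slope
    at both endpoints. *)
Lemma PhiL_wave (w c L : R) :
  admissible w c -> 0 < L ->
  let e := eta3L w c L in
  alpha0 w c < e < alpha1 w c -> Tper w c e = 2 * L ->
  exists dF s ds, wave w c e L (PhiL w c L) dF s ds /\ dF L = 0 /\ dF (- L) = 0.
Proof.
intros Hwc HL e He HT.
destruct (eta_order w c e Hwc He) as [[H1 H2] H3].
destruct (kmod_sqr w c e Hwc He) as (Ek & [K0 K1] & _).
assert (Hg := gpar_pos w c e Hwc He).
set (k := kmod w c e) in *. set (g := gpar w c e) in *.
assert (Hk : k ^ 2 < 1) by lra.
assert (Hb : betasq w c e = (e - eta2 w c e) / (eta2 w c e - eta1 w c e)).
{ unfold betasq, ksq. field. lra. }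
assert (Hr : 0 < / (2 * g)) by (apply Rinv_0_lt_compat; lra).
assert (Er : (/ (2 * g)) ^ 2 = e * (eta2 w c e - eta1 w c e) / 16).
{ assert (P : 0 < e * (eta2 w c e - eta1 w c e)) by nra.
  assert (Q := sqrt_lt_R0 _ P). unfold g, gpar.
  rewrite <- (pow2_sqrt (e * (eta2 w c e - eta1 w c e))) at 2 by lra. field. lra. }
set (th := fun x => am k (x / (2 * g))).
assert (HK : EllK k = L / (2 * g)).
{ apply Rmult_eq_reg_l with (4 * g); [|lra].
  unfold Tper in HT. fold g k in HT. rewrite HT. field. lra. }
assert (thL : th L = PI / 2) by (unfold th; rewrite <- HK; now apply am_EllK).
assert (th0 : th 0 = 0).
{ unfold th. replace (0 / (2 * g)) with 0 by (field; lra). now apply am_0. }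
assert (thodd : forall x, th (- x) = - th x).
{ intros x. unfold th. replace (- x / (2 * g)) with (- (x / (2 * g))) by (field; lra). now apply am_odd. }
assert (thmono : forall x y, x <= y -> th x <= th y).
{ intros x y Hxy. apply am_mono; [easy|]. apply Rmult_le_compat_r; lra. }
set (S := fun x => sin (th x)). set (C := fun x => cos (th x)).
set (D := fun x => sqrt (1 - k ^ 2 * S x ^ 2)).
assert (Dp : forall x, 0 < 1 - k ^ 2 * S x ^ 2).
{ intros x. generalize (one_minus_ksin_pos k (th x) Hk). unfold S. lra. }
assert (Dpos : forall x, 0 < D x) by (intros x; now apply sqrt_lt_R0).
assert (ED : forall x, D x ^ 2 = 1 - k ^ 2 * S x ^ 2).
{ intros x. apply pow2_sqrt. specialize (Dp x). lra. }
assert (dth : forall x, is_derive th x (/ (2 * g) * D x)).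
{ intros x. apply (is_derive_comp (am k) (fun x => x / (2 * g))).
  - now apply is_derive_am.
  - auto_derive; [lra|]. field. lra. }
assert (dS : forall x, is_derive S x (/ (2 * g) * C x * D x)).
{ intros x. unfold S. evar_last.
  - apply (is_derive_comp sin th); [|apply dth]. apply is_derive_Reals, derivable_pt_lim_sin.
  - unfold scal; simpl; unfold mult; simpl. unfold C. ring. }
assert (dC : forall x, is_derive C x (- (/ (2 * g) * S x * D x))).
{ intros x. unfold C. evar_last.
  - apply (is_derive_comp cos th); [|apply dth]. apply is_derive_Reals, derivable_pt_lim_cos.
  - unfold scal; simpl; unfold mult; simpl. unfold S. ring. }
assert (dD : forall x, is_derive D x (- (/ (2 * g) * ksq w c e * S x * C x))).
{ intros x. evar_last.
  - apply (is_derive_sqrt (fun x => 1 - k ^ 2 * S x ^ 2)); [|apply Dp].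
    apply (is_derive_minus (fun _ => 1)); [apply (is_derive_const 1)|].
    apply is_derive_scal. apply is_derive_pow. apply dS.
  - fold (D x). specialize (Dpos x). rewrite Ek.
    unfold minus, plus, opp, zero; simpl. field. lra. }
exists (jacobi_slope e (ksq w c e) (betasq w c e) (/ (2 * g)) S C).
eexists. eexists. split; [|split].
- apply (wave_of_jacobi w c e L (ksq w c e) (betasq w c e) (/ (2 * g)) _ S C D); try easy.
  + intros x. unfold S, C. generalize (sin2_cos2 (th x)). unfold Rsqr. lra.
  + intros x. now rewrite ED, Ek.
  + unfold S. rewrite th0. apply sin_0.
  + unfold D, S. rewrite th0, sin_0. replace (1 - k ^ 2 * 0 ^ 2) with 1 by ring. apply sqrt_1.
  + intros x. unfold S. now rewrite thodd, sin_neg.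
  + intros x. unfold D, S. rewrite thodd, sin_neg.
    now replace ((- sin (th x)) ^ 2) with (sin (th x) ^ 2) by ring.
  + intros x Hx. assert (A := thmono 0 x ltac:(lra)). assert (B := thmono x L ltac:(lra)).
    rewrite th0 in A. rewrite thL in B. generalize PI_RGT_0. intros.
    split; [apply sin_ge_0; lra|apply cos_ge_0; lra].
  + intros x. unfold PhiL. fold e. fold k g. unfold dn, sn. fold (th x). fold (S x). fold (D x).
    rewrite sqrt_div_alt, sqrt_mult_alt, sqrt_pow2; try easy.
    * left. apply Dpos.
    * left. nra.
    * assert (0 < betasq w c e) by (rewrite Hb; apply Rdiv_lt_0_compat; lra).
      generalize (pow2_ge_0 (S x)). nra.
- unfold jacobi_slope, C. rewrite thL, cos_PI2. unfold Rdiv. ring.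
- unfold jacobi_slope, C. rewrite thodd, cos_neg, thL, cos_PI2. unfold Rdiv. ring.
Qed.

(** * Convergence *)

(** A termwise bound for the derivative of [force] on [[0, sqrt a]]; [a] bounds the square of the
    profile. *)
Definition force_lip (w c a : R) : R :=
  Rabs (w - c ^ 2 / 4) + 3 / 2 * Rabs c * a + 15 / 16 * a ^ 2.

Lemma force_lip_nonneg (w c a : R) : 0 <= a -> 0 <= force_lip w c a.
Proof.
intros Ha. unfold force_lip.
generalize (Rabs_pos (w - c ^ 2 / 4)) (Rabs_pos c). intros. nra.
Qed.

Lemma force_lipschitz (w c b u v : R) :
  0 <= u <= b -> 0 <= v <= b ->
  Rabs (force w c u - force w c v) <= force_lip w c (b ^ 2) * Rabs (u - v).
Proof.
intros Hu Hv. unfold force.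
replace ((w - c ^ 2 / 4) * u + c / 2 * u ^ 3 - 3 / 16 * u ^ 5 -
  ((w - c ^ 2 / 4) * v + c / 2 * v ^ 3 - 3 / 16 * v ^ 5)) with
  (((w - c ^ 2 / 4) + c * ((u ^ 2 + u * v + v ^ 2) / 2)
    + - (3 / 16 * (u ^ 4 + u ^ 3 * v + u ^ 2 * v ^ 2 + u * v ^ 3 + v ^ 4))) * (u - v)) by field.
rewrite Rabs_mult. apply Rmult_le_compat_r; [apply Rabs_pos|].
assert (A : u ^ 2 <= b ^ 2) by nra. assert (B : v ^ 2 <= b ^ 2) by nra.
assert (C : 0 <= u * v <= b ^ 2) by nra.
assert (A0 := pow2_ge_0 u). assert (B0 := pow2_ge_0 v).
eapply Rle_trans; [apply Rabs_triang|]. rewrite Rabs_Ropp.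
apply Rplus_le_compat; [eapply Rle_trans; [apply Rabs_triang|apply Rplus_le_compat; [lra|]]|].
- rewrite Rabs_mult, (Rabs_right ((u ^ 2 + u * v + v ^ 2) / 2)) by lra.
  generalize (Rabs_pos c). nra.
- replace (u ^ 4 + u ^ 3 * v + u ^ 2 * v ^ 2 + u * v ^ 3 + v ^ 4)
    with (u ^ 2 * u ^ 2 + u ^ 2 * (u * v) + u ^ 2 * v ^ 2 + v ^ 2 * (u * v) + v ^ 2 * v ^ 2) by ring.
  replace ((b ^ 2) ^ 2) with (b ^ 2 * b ^ 2) by ring.
  set (x := u ^ 2) in *. set (y := v ^ 2) in *. set (z := u * v) in *. set (t := b ^ 2) in *.
  assert (P : forall p q, 0 <= p <= t -> 0 <= q <= t -> 0 <= p * q <= t * t).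
  { intros p q Hp Hq. split; [apply Rmult_le_pos; lra|apply Rmult_le_compat; lra]. }
  assert (P1 := P x x ltac:(lra) ltac:(lra)). assert (P2 := P x z ltac:(lra) ltac:(lra)).
  assert (P3 := P x y ltac:(lra) ltac:(lra)). assert (P4 := P y z ltac:(lra) ltac:(lra)).
  assert (P5 := P y y ltac:(lra) ltac:(lra)).
  rewrite Rabs_right by lra. lra.
Qed.

(** The energy [E = D^2 + D'^2] satisfies [E' <= 2 (1 + M) |D D'| <= (1 + M) E], so
    [E exp (- (1 + M) t)] decreases. *)
Lemma gronwall_second_order (D dD ddD : R -> R) (M x : R) :
  0 <= M ->
  (forall t, is_derive D t (dD t)) -> (forall t, is_derive dD t (ddD t)) ->
  (forall t, Rabs (ddD t) <= M * Rabs (D t)) -> dD 0 = 0 -> 0 <= x ->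
  D x ^ 2 <= D 0 ^ 2 * exp ((1 + M) * x).
Proof.
intros HM H1 H2 HL H0 Hx.
assert (X : - (D 0 ^ 2 + dD 0 ^ 2) * exp (- (1 + M) * 0)
         <= - (D x ^ 2 + dD x ^ 2) * exp (- (1 + M) * x)).
{ apply (derive_nonneg_incr (fun x => - (D x ^ 2 + dD x ^ 2) * exp (- (1 + M) * x))
    (fun x => ((1 + M) * (D x ^ 2 + dD x ^ 2) - 2 * D x * dD x - 2 * dD x * ddD x)
              * exp (- (1 + M) * x))); [easy| |].
  - intros t _. assert (h1 := H1 t). assert (h2 := H2 t).
    auto_derive.
    + repeat split; [now exists (dD t)|now exists (ddD t)].
    + replace (Derive _ t) with (dD t) by (symmetry; now apply is_derive_unique).
      replace (Derive _ t) with (ddD t) by (symmetry; now apply is_derive_unique). ring.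
  - intros t _. apply Rmult_le_pos; [|left; apply exp_pos].
    assert (A : Rabs (dD t * ddD t) <= Rabs (dD t) * (M * Rabs (D t))).
    { rewrite Rabs_mult. apply Rmult_le_compat_l; [apply Rabs_pos|apply HL]. }
    assert (B : Rabs (D t * dD t) = Rabs (dD t) * Rabs (D t)) by (rewrite Rabs_mult; ring).
    generalize (Rle_abs (dD t * ddD t)) (Rle_abs (D t * dD t)). intros.
    rewrite <- (pow2_abs (D t)), <- (pow2_abs (dD t)).
    assert (0 <= (1 + M) * (Rabs (D t) - Rabs (dD t)) ^ 2)
      by (apply Rmult_le_pos; [lra|apply pow2_ge_0]).
    nra. }
rewrite H0 in X. replace (- (1 + M) * 0) with 0 in X by ring. rewrite exp_0 in X.
replace (- (1 + M) * x) with (- ((1 + M) * x)) in X by ring. rewrite exp_Ropp in X.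
assert (P := exp_pos ((1 + M) * x)). set (y := exp ((1 + M) * x)) in *.
apply Rmult_le_reg_r with (/ y); [now apply Rinv_0_lt_compat|].
rewrite Rmult_assoc, Rinv_r by lra.
assert (0 <= dD x ^ 2 * / y) by (apply Rmult_le_pos; [apply pow2_ge_0|left; now apply Rinv_0_lt_compat]).
lra.
Qed.

(* The energy [dF^2 - V(F)] is conserved. *)
Lemma wave_slope_bounded (w c e L : R) (F dF s ds : R -> R) :
  wave w c e L F dF s ds -> exists K, 0 <= K /\ forall x, Rabs (dF x) <= K.
Proof.
intros W.
assert (D1 := wave_derive _ _ _ _ _ _ _ _ W). assert (D2 := wave_force _ _ _ _ _ _ _ _ W).
assert (rng := wave_range _ _ _ _ _ _ _ _ W).
set (V := fun u : R => (w - c ^ 2 / 4) * u ^ 2 + c / 4 * u ^ 4 - u ^ 6 / 16).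
assert (E : forall x, dF x ^ 2 = V (F x) - V (F 0)).
{ intros x.
  assert (H : forall t, is_derive (fun t => dF t ^ 2 - V (F t)) t 0).
  { intros t. assert (h1 := D1 t). assert (h2 := D2 t). unfold V.
    auto_derive.
    + repeat split; [now exists (force w c (F t))|now exists (dF t)..].
    + replace (Derive _ t) with (force w c (F t)) by (symmetry; now apply is_derive_unique).
      replace (Derive _ t) with (dF t) by (symmetry; now apply is_derive_unique).
      unfold force. field. }
  destruct (MVT_gen (fun t => dF t ^ 2 - V (F t)) 0 x (fun _ => 0)) as (z & _ & Hz).
  - intros t _. apply H.
  - intros t _. apply continuity_pt_filterlim. apply (is_derive_continuous _ _ 0 (H t)).
  - rewrite (wave_slope_0 _ _ _ _ _ _ _ _ W) in Hz. lra. }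
set (b := sqrt e) in *.
set (K2 := Rabs (w - c ^ 2 / 4) * b ^ 2 + Rabs c / 4 * b ^ 4 + b ^ 6 / 16).
assert (VB : forall x, Rabs (V (F x)) <= K2).
{ intros x. unfold V, K2, Rminus. assert (R := rng x).
  assert (PB : forall n, 0 <= F x ^ n <= b ^ n).
  { intros n. split; [apply pow_le; lra|apply pow_incr; lra]. }
  assert (P2 := PB 2%nat). assert (P4 := PB 4%nat). assert (P6 := PB 6%nat).
  eapply Rle_trans; [apply Rabs_triang|]. apply Rplus_le_compat.
  - eapply Rle_trans; [apply Rabs_triang|]. apply Rplus_le_compat.
    + rewrite Rabs_mult, (Rabs_right (F x ^ 2)) by lra.
      apply Rmult_le_compat_l; [apply Rabs_pos|lra].
    + rewrite Rabs_mult, (Rabs_right (F x ^ 4)) by lra. unfold Rdiv.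
      rewrite Rabs_mult, (Rabs_right (/ 4)) by lra.
      apply Rmult_le_compat_l; [|lra]. generalize (Rabs_pos c). lra.
  - rewrite Rabs_Ropp, Rabs_right; lra. }
exists (sqrt (2 * K2)). split; [apply sqrt_pos|]. intros x.
rewrite <- (sqrt_pow2 (Rabs (dF x))) by apply Rabs_pos. apply sqrt_le_1_alt.
rewrite pow2_abs, E. generalize (VB x) (VB 0) (Rle_abs (V (F x))) (Rle_abs (- V (F 0))).
rewrite Rabs_Ropp. lra.
Qed.

(** The divisor [sqrt (e - F r ^ 2)] gives way to [sqrt a / 2], free of [e], so that one bound
    serves the solitary wave and the periodic waves near it. *)
Lemma wave_tail_small (w c e L a u r : R) (F dF s ds : R -> R) :
  wave w c e L F dF s ds -> 0 <= r <= L -> F r <= u -> 0 < a -> a / 4 <= e - u ^ 2 ->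
  RInt (fun x => F x ^ 2) r L <= 8 * u / sqrt a.
Proof.
intros W Hr Hu Ha Hae.
assert (rng := wave_range _ _ _ _ _ _ _ _ W r).
assert (F r ^ 2 <= u ^ 2) by nra.
assert (P := sqrt_lt_R0 a Ha).
assert (Hk : sqrt a / 2 <= sqrt (e - F r ^ 2)).
{ rewrite <- (sqrt_pow2 (sqrt a / 2)) by lra. apply sqrt_le_1_alt.
  replace ((sqrt a / 2) ^ 2) with (sqrt a ^ 2 / 4) by field. rewrite pow2_sqrt by lra. lra. }
eapply Rle_trans; [apply (wave_tail w c e L F dF s ds r W Hr); lra|].
set (k := sqrt (e - F r ^ 2)) in *.
apply Rle_trans with (4 * u / k).
- apply Rmult_le_compat_r; [left; apply Rinv_0_lt_compat|]; lra.
- replace (8 * u / sqrt a) with (4 * u / (sqrt a / 2)) by (field; lra).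
  apply Rmult_le_compat_l; [lra|]. apply Rinv_le_contravar; lra.
Qed.

Lemma sqrt_diff_sqr (a e : R) : 0 < e <= a -> (sqrt e - sqrt a) ^ 2 <= a - e.
Proof.
intros H. assert (A := pow2_sqrt a ltac:(lra)). assert (B := pow2_sqrt e ltac:(lra)).
assert (C := sqrt_le_1_alt e a ltac:(lra)). generalize (sqrt_pos e). nra.
Qed.

Lemma wave_continuous (w c e L : R) (F dF s ds : R -> R) :
  wave w c e L F dF s ds -> forall x, continuous F x /\ continuous dF x.
Proof.
intros W x. split.
- apply (is_derive_continuous F x (dF x)), (wave_derive _ _ _ _ _ _ _ _ W).
- apply (is_derive_continuous dF x (force w c (F x))), (wave_force _ _ _ _ _ _ _ _ W).
Qed.

Lemma continuous_sqr (f : R -> R) (x : R) : continuous f x -> continuous (fun t => f t ^ 2) x.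
Proof.
intros Hf. apply (continuous_ext (fun t => f t * f t)); [intros; simpl; ring|].
now apply (continuous_mult f f).
Qed.

(* Gronwall on [0, r], integrable tails on [r, L]. *)
Lemma wave_dist (w c e a L u r : R) (F dF s ds G dG t dt : R -> R) :
  0 < e <= a -> wave w c a L F dF s ds -> wave w c e L G dG t dt ->
  0 <= r <= L -> F r <= u -> 16 * u ^ 2 <= a -> a <= 2 * e ->
  (a - e) * exp ((1 + force_lip w c a) * r) <= u ^ 2 ->
  RInt (fun x => (G x - F x) ^ 2) 0 L
    <= r * ((a - e) * exp ((1 + force_lip w c a) * r)) + 24 * u / sqrt a /\
  Rabs (G L - F L) <= 2 * u.
Proof.
intros He WF WG Hr Hu Hua Hea HX.
assert (Cf := wave_continuous _ _ _ _ _ _ _ _ WF).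
assert (Cg := wave_continuous _ _ _ _ _ _ _ _ WG).
assert (rF := wave_range _ _ _ _ _ _ _ _ WF). assert (rG := wave_range _ _ _ _ _ _ _ _ WG).
assert (sqrt_le := sqrt_le_1_alt e a ltac:(lra)).
assert (M0 := force_lip_nonneg w c a ltac:(lra)).
set (M := force_lip w c a) in *.
assert (u0 : 0 < u) by (generalize (rF r); lra).
assert (gw : forall x, 0 <= x <= r -> (G x - F x) ^ 2 <= (a - e) * exp ((1 + M) * r)).
{ intros x Hx. eapply Rle_trans.
  - apply (gronwall_second_order (fun x => G x - F x) (fun x => dG x - dF x)
      (fun x => force w c (G x) - force w c (F x)) M); try easy.
    + intros y. apply (is_derive_minus G F).
      * apply (wave_derive _ _ _ _ _ _ _ _ WG).
      * apply (wave_derive _ _ _ _ _ _ _ _ WF).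
    + intros y. apply (is_derive_minus dG dF).
      * apply (wave_force _ _ _ _ _ _ _ _ WG).
      * apply (wave_force _ _ _ _ _ _ _ _ WF).
    + intros y. unfold M. rewrite <- (pow2_sqrt a) by lra.
      apply force_lipschitz; [generalize (rG y)|generalize (rF y)]; lra.
    + rewrite (wave_slope_0 _ _ _ _ _ _ _ _ WG), (wave_slope_0 _ _ _ _ _ _ _ _ WF). ring.
  - rewrite (wave_top _ _ _ _ _ _ _ _ WG), (wave_top _ _ _ _ _ _ _ _ WF).
    apply Rmult_le_compat; [apply pow2_ge_0|left; apply exp_pos|now apply sqrt_diff_sqr|].
    destruct (Req_dec x r) as [->|Hne]; [lra|]. left. apply exp_increasing. nra. }
assert (Gr : G r <= 2 * u).
{ assert (H := gw r ltac:(lra)). assert (G r - F r <= u); [|lra].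
  destruct (Rle_dec (G r - F r) 0) as [n|n]; [lra|].
  apply Rsqr_incr_0_var; [unfold Rsqr; nra|lra]. }
assert (decr : forall e' K dK s' ds', wave w c e' L K dK s' ds' -> K L <= K r).
{ intros e' K dK s' ds' W. assert (- K r <= - K L); [|lra].
  apply (derive_nonneg_incr (fun x => - K x) (fun x => - dK x)); try lra.
  - intros y Hy. apply (is_derive_opp K). apply (wave_derive _ _ _ _ _ _ _ _ W).
  - intros y Hy. generalize (wave_decr _ _ _ _ _ _ _ _ W y ltac:(lra)). lra. }
assert (CD : forall x, continuous (fun x => (G x - F x) ^ 2) x).
{ intros x. apply (continuous_sqr (fun x => G x - F x)).
  apply (continuous_minus G F); [apply Cg|apply Cf]. }
split.
- rewrite <- (RInt_Chasles _ 0 r L) by now apply ex_RInt_everywhere_continuous.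
  unfold plus; simpl. apply Rplus_le_compat.
  + set (k := (a - e) * exp ((1 + M) * r)) in *.
    replace (r * k) with (k * r - k * 0) by ring.
    apply (RInt_le_increment _ (fun x => k * x) (fun _ => k)); [lra|exact CD| |].
    * intros x _. auto_derive; [easy|ring].
    * intros x Hx. apply gw. lra.
  + assert (XF : ex_RInt (fun x => F x ^ 2) r L).
    { apply ex_RInt_everywhere_continuous. intros; apply continuous_sqr, Cf. }
    assert (XG : ex_RInt (fun x => G x ^ 2) r L).
    { apply ex_RInt_everywhere_continuous. intros; apply continuous_sqr, Cg. }
    apply Rle_trans with (RInt (fun x => G x ^ 2 + F x ^ 2) r L).
    * apply RInt_le; [lra|now apply ex_RInt_everywhere_continuous|
        now apply (ex_RInt_plus (fun x => G x ^ 2))|].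
      intros x _. generalize (rF x) (rG x). nra.
    * rewrite (RInt_plus (fun x => G x ^ 2)) by easy. unfold plus; simpl.
      (* [e >= a / 2] and [4 u^2 <= a / 4] supply the last hypothesis. The tails cost
         [16 u / sqrt a] and [8 u / sqrt a], whence the 24. *)
      assert (T1 := wave_tail_small w c e L a (2 * u) r G dG t dt WG Hr Gr ltac:(lra) ltac:(nra)).
      assert (T2 := wave_tail_small w c a L a u r F dF s ds WF Hr Hu ltac:(lra) ltac:(nra)).
      simpl in T1, T2. unfold Rdiv in *. lra.
- assert (A := decr _ _ _ _ _ WF). assert (B := decr _ _ _ _ _ WG).
  generalize (rF L) (rG L). intros. apply Rabs_le. lra.
Qed.

Lemma sobolev_terms (D dD ddD : R -> R) (M L : R) :
  0 <= L ->
  (forall t, is_derive D t (dD t)) -> (forall t, is_derive dD t (ddD t)) ->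
  (forall t, continuous ddD t) ->
  (forall t, Rabs (ddD t) <= M * Rabs (D t)) ->
  RInt (fun t => dD t ^ 2) (- L) L
    <= D L * dD L - D (- L) * dD (- L) + M * RInt (fun t => D t ^ 2) (- L) L /\
  RInt (fun t => ddD t ^ 2) (- L) L <= M ^ 2 * RInt (fun t => D t ^ 2) (- L) L.
Proof.
intros HL H1 H2 Hc HM.
assert (C0 : forall t, continuous (fun t => D t ^ 2) t).
{ intros t. apply continuous_sqr. apply (is_derive_continuous D t (dD t)), H1. }
assert (C1 : forall t, continuous (fun t => dD t ^ 2) t).
{ intros t. apply continuous_sqr. apply (is_derive_continuous dD t (ddD t)), H2. }
split.
- replace (D L * dD L - D (- L) * dD (- L) + M * RInt (fun t => D t ^ 2) (- L) L)
    with ((D L * dD L + M * RInt (fun t => D t ^ 2) (- L) L)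
          - (D (- L) * dD (- L) + M * RInt (fun t => D t ^ 2) (- L) (- L)))
    by (rewrite RInt_point; change (@zero R_CompleteNormedModule) with 0; ring).
  (* Integration by parts as a comparison: the derivative of [D D' + M * RInt D^2] is at least
     [D'^2], because [|D D''| <= M D^2]. *)
  apply (RInt_le_increment _ (fun x => D x * dD x + M * RInt (fun t => D t ^ 2) (- L) x)
    (fun x => (dD x * dD x + D x * ddD x) + M * D x ^ 2)); [lra|exact C1| |].
  + intros x _. apply (is_derive_plus (fun x => D x * dD x)).
    * apply (is_derive_mult D dD); [apply H1|apply H2|exact Rmult_comm].
    * apply is_derive_scal. now apply (is_derive_primitive (fun t => D t ^ 2)).
  + intros x _.
    assert (A : Rabs (D x * ddD x) <= Rabs (D x) * (M * Rabs (D x))).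
    { rewrite Rabs_mult. apply Rmult_le_compat_l; [apply Rabs_pos|apply HM]. }
    generalize (Rle_abs (- (D x * ddD x))). rewrite Rabs_Ropp, <- (pow2_abs (D x)). nra.
- assert (X : ex_RInt (fun t => D t ^ 2) (- L) L) by now apply ex_RInt_everywhere_continuous.
  rewrite <- (RInt_scal (fun t => D t ^ 2)) by easy.
  apply RInt_le; [lra| |now apply (ex_RInt_scal (fun t => D t ^ 2))|].
  + apply ex_RInt_everywhere_continuous. intros t. now apply continuous_sqr.
  + intros x _. unfold scal; simpl; unfold mult; simpl.
    change (ddD x ^ 2 <= M ^ 2 * D x ^ 2).
    rewrite <- (pow2_abs (ddD x)), <- (pow2_abs (D x)), <- Rpow_mult_distr.
    apply pow_incr. split; [apply Rabs_pos|apply HM].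
Qed.

Lemma force_continuous (w c : R) (F : R -> R) (x : R) :
  continuous F x -> continuous (fun t => force w c (F t)) x.
Proof.
intros H. apply (continuous_comp F (force w c)); [easy|].
apply (ex_derive_continuous (force w c)). unfold force. now auto_derive.
Qed.

(** All three terms are nonnegative, so the bound for [m = 2] serves the smaller orders too. *)
Lemma Hnorm_le (D dD ddD : R -> R) (m : nat) (L b : R) :
  (m <= 2)%nat -> 0 <= L ->
  (forall t, is_derive D t (dD t)) -> (forall t, is_derive dD t (ddD t)) ->
  (forall t, continuous ddD t) ->
  RInt (fun t => D t ^ 2) (- L) L + RInt (fun t => dD t ^ 2) (- L) L
    + RInt (fun t => ddD t ^ 2) (- L) L <= b ->
  Hnorm m L D <= sqrt b.
Proof.
intros Hm HL H1 H2 Hc Hb. unfold Hnorm. apply sqrt_le_1_alt.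
assert (P : forall f : R -> R, (forall t, continuous f t) -> 0 <= RInt (fun t => f t ^ 2) (- L) L).
{ intros f Hf. apply RInt_ge_0; [lra| |intros; apply pow2_ge_0].
  apply ex_RInt_everywhere_continuous. intros t. now apply continuous_sqr. }
assert (P0 := P D (fun t => is_derive_continuous D t (dD t) (H1 t))).
assert (P1 := P dD (fun t => is_derive_continuous dD t (ddD t) (H2 t))).
assert (P2 := P ddD Hc).
assert (E1 : forall x, Derive_n D 1 x = dD x).
{ intros x. apply is_derive_unique, H1. }
assert (E2 : forall x, Derive_n D 2 x = ddD x).
{ intros x. change (Derive_n D 2 x) with (Derive (Derive_n D 1) x).
  rewrite (Derive_ext _ dD _ E1). apply is_derive_unique, H2. }
assert (I1 : RInt (fun x => Derive_n D 1 x ^ 2) (- L) L = RInt (fun t => dD t ^ 2) (- L) L).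
{ apply RInt_ext. intros x _. now rewrite E1. }
assert (I2 : RInt (fun x => Derive_n D 2 x ^ 2) (- L) L = RInt (fun t => ddD t ^ 2) (- L) L).
{ apply RInt_ext. intros x _. now rewrite E2. }
destruct m as [|[|[|m]]]; [| | |lia]; cbn [sum_f_R0]; rewrite ?I1, ?I2;
  change (Derive_n D 0) with D; lra.
Qed.

Theorem theorem4p2 (w c : R)
  (Hwc : c ^ 2 / 4 < w \/ (w = c ^ 2 / 4 /\ 0 < c))
  (m : nat) (Hm : (m <= 2)%nat) :
  is_lim (fun L => Hnorm m L (fun x => PhiL w c L x - Phi w c x)) p_infty 0.
Proof.
destruct (alpha0_bounds w c Hwc) as [[A1 A2] _].
destruct (Phi_wave w c Hwc) as (dF & WF & Hdecay).
destruct (wave_slope_bounded _ _ _ _ _ _ _ _ (WF 0)) as (K & HK & HdF).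
set (F := Phi w c) in *. set (a := alpha1 w c) in *.
set (M := force_lip w c a).
assert (HM : 0 <= M) by (apply force_lip_nonneg; lra).
apply is_lim_spec. intros eps. simpl.
set (tau := eps ^ 2).
assert (Ht : 0 < tau) by (apply pow_lt, cond_pos).
assert (ra : 0 < sqrt a) by (apply sqrt_lt_R0; lra).
(* By [sobolev_terms] the three integrals add up to at most a boundary term plus [C] times the
   integral of [D^2]. *)
set (C := 1 + M + M ^ 2). assert (HC : 1 <= C) by (unfold C; nra).
(* The three entries ensure [16 u^2 <= a], a boundary term of at most [tau / 4], and tails of at
   most [tau / 4] after the factor [C] and the doubling of [[0, L]] to [[- L, L]]. [K + 1] avoids a
   division by 0, as does [r + 1] in [gap]. *)
set (u := Rmin (sqrt a / 4) (Rmin (tau / (16 * (K + 1))) (tau * sqrt a / (192 * C)))).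
assert (U0 : 0 < u).
{ repeat apply Rmin_glb_lt; [lra|apply Rdiv_lt_0_compat; lra|apply Rdiv_lt_0_compat; nra]. }
assert (U1 : u <= sqrt a / 4) by apply Rmin_l.
assert (U2 : u <= tau / (16 * (K + 1))) by (eapply Rle_trans; [apply Rmin_r|apply Rmin_l]).
assert (U3 : u <= tau * sqrt a / (192 * C)) by (eapply Rle_trans; [apply Rmin_r|apply Rmin_r]).
destruct (Hdecay u U0) as (r & Hr & Fr).
set (X := exp ((1 + M) * r)). assert (HX : 0 < X) by apply exp_pos.
(* [gap] must come after [r], since [X] is the Gronwall factor on [[0, r]]. The entries ensure
   [a <= 2 e], closeness [u] at [r], and a share of [tau / 4] for [[0, r]]. *)
set (gap := Rmin (a / 2) (Rmin (u ^ 2 / X) (tau / (8 * C * (r + 1) * X)))).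
assert (G0 : 0 < gap).
{ repeat apply Rmin_glb_lt; [lra| |]; apply Rdiv_lt_0_compat; try easy; [nra|].
  repeat apply Rmult_lt_0_compat; lra. }
assert (G1 : gap <= a / 2) by apply Rmin_l.
assert (G2 : gap <= u ^ 2 / X) by (eapply Rle_trans; [apply Rmin_r|apply Rmin_l]).
assert (G3 : gap <= tau / (8 * C * (r + 1) * X)) by (eapply Rle_trans; [apply Rmin_r|apply Rmin_r]).
destruct (eta3L_lim w c gap Hwc G0) as (N & HN & Heta).
(* [L >= r] is required for the splitting point to lie in [[0, L]]. *)
exists (N + r). intros L HL.
destruct (Heta L ltac:(lra)) as (He & HT & Hgap). fold a in Hgap.
destruct (PhiL_wave w c L Hwc ltac:(lra) He HT) as (dG & s & ds & WG & dGL & dGmL).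
set (e := eta3L w c L) in *. set (G := PhiL w c L) in *.
assert (W := WF L).
assert (GX : (a - e) * X <= u ^ 2).
{ apply Rmult_le_reg_r with (/ X); [now apply Rinv_0_lt_compat|].
  rewrite Rmult_assoc, Rinv_r by lra. unfold Rdiv in G2. lra. }
destruct (wave_dist w c e a L u r F dF F dF G dG s ds) as [I0 BL]; try easy; try lra.
{ unfold a; lra. }
{ rewrite <- (pow2_sqrt a) by lra. nra. }
fold M X in I0.
set (D := fun x => G x - F x). set (dD := fun x => dG x - dF x).
set (ddD := fun x => force w c (G x) - force w c (F x)).
assert (D1 : forall x, is_derive D x (dD x)).
{ intros x. apply (is_derive_minus G F).
  - apply (wave_derive _ _ _ _ _ _ _ _ WG).
  - apply (wave_derive _ _ _ _ _ _ _ _ W). }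
assert (D2 : forall x, is_derive dD x (ddD x)).
{ intros x. apply (is_derive_minus dG dF).
  - apply (wave_force _ _ _ _ _ _ _ _ WG).
  - apply (wave_force _ _ _ _ _ _ _ _ W). }
assert (D3 : forall x, continuous ddD x).
{ intros x. apply (continuous_minus (fun x => force w c (G x)) (fun x => force w c (F x)));
    apply force_continuous.
  - apply (wave_continuous _ _ _ _ _ _ _ _ WG).
  - apply (wave_continuous _ _ _ _ _ _ _ _ W). }
assert (D4 : forall x, Rabs (ddD x) <= M * Rabs (D x)).
{ intros x. unfold M. rewrite <- (pow2_sqrt a) by lra.
  assert (S := sqrt_le_1_alt e a ltac:(unfold a; lra)).
  generalize (wave_range _ _ _ _ _ _ _ _ WG x) (wave_range _ _ _ _ _ _ _ _ W x). intros.
  apply force_lipschitz; lra. }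
destruct (sobolev_terms D dD ddD M L ltac:(lra) D1 D2 D3 D4) as [I1 I2].
assert (Deven : forall x, D (- x) = D x).
{ intros x. unfold D. rewrite (wave_even _ _ _ _ _ _ _ _ WG), (wave_even _ _ _ _ _ _ _ _ W). reflexivity. }
assert (IE : RInt (fun t => D t ^ 2) (- L) L = 2 * RInt (fun t => D t ^ 2) 0 L).
{ apply (RInt_even (fun t => D t ^ 2)).
  - intros x. apply continuous_sqr. apply (is_derive_continuous D x (dD x)), D1.
  - intros x. now rewrite Deven. }
change (RInt (fun x => (G x - F x) ^ 2) 0 L) with (RInt (fun t => D t ^ 2) 0 L) in I0.
change (Rabs (D L) <= 2 * u) in BL.
set (J := RInt (fun t => D t ^ 2) (- L) L) in *.
assert (T1 : 4 * u * K <= tau / 4).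
{ apply Rle_trans with (4 * (tau / (16 * (K + 1))) * (K + 1)).
  - apply Rmult_le_compat; lra.
  - apply Req_le. field. lra. }
assert (T2 : C * (48 * u / sqrt a) <= tau / 4).
{ apply Rle_trans with (C * (48 * (tau * sqrt a / (192 * C)) / sqrt a)).
  - apply Rmult_le_compat_l; [lra|]. apply Rmult_le_compat_r; [left; now apply Rinv_0_lt_compat|lra].
  - apply Req_le. field. lra. }
assert (T3 : C * (2 * (r * ((a - e) * X))) <= tau / 4).
{ apply Rle_trans with (C * (2 * ((r + 1) * (tau / (8 * C * (r + 1) * X) * X)))).
  - assert (0 <= (a - e) * X <= tau / (8 * C * (r + 1) * X) * X).
    { split; [apply Rmult_le_pos; [unfold a; lra|lra]|apply Rmult_le_compat_r; lra]. }
    apply Rmult_le_compat_l; [lra|]. apply Rmult_le_compat_l; [lra|].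
    apply Rmult_le_compat; lra.
  - apply Req_le. field. lra. }
(* The periodic slope vanishes at both ends, so only the bounded slope of the solitary wave is left,
   multiplied by [|D L| <= 2 u]. *)
assert (B : D L * dD L - D (- L) * dD (- L) <= 4 * u * K).
{ rewrite Deven. unfold dD. rewrite dGL, dGmL.
  replace (D L * (0 - dF L) - D L * (0 - dF (- L))) with (D L * (dF (- L) - dF L)) by ring.
  eapply Rle_trans; [apply Rle_abs|]. rewrite Rabs_mult.
  replace (4 * u * K) with (2 * u * (2 * K)) by ring.
  apply Rmult_le_compat; [apply Rabs_pos|apply Rabs_pos|easy|].
  unfold Rminus. eapply Rle_trans; [apply Rabs_triang|]. rewrite Rabs_Ropp.
  generalize (HdF L) (HdF (- L)). lra. }
assert (CJ : C * J <= tau / 4 + tau / 4).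
{ apply Rle_trans with (C * (2 * (r * ((a - e) * X)) + 48 * u / sqrt a)).
  - apply Rmult_le_compat_l; [lra|]. unfold Rdiv in *. lra.
  - lra. }
assert (S : Hnorm m L D <= sqrt (tau * (3 / 4))).
{ apply (Hnorm_le D dD ddD); try easy; [lra|]. fold J. unfold C in CJ. lra. }
assert (S0 : 0 <= Hnorm m L D) by apply sqrt_pos.
change (Rabs (Hnorm m L D - 0) < eps).
rewrite Rminus_0_r, Rabs_right by lra.
eapply Rle_lt_trans; [exact S|].
rewrite <- (sqrt_pow2 eps) by (left; apply cond_pos). apply sqrt_lt_1_alt. fold tau. lra.
Qed.
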